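(* Assume (A1), (A2), (A3), (A4). Then the multi-cluster game in which each cluster $h$ solves $\min_{\mathbf x^h\in\mathbb R^{q_h}}F^h(\mathbf x^h,\mathbf x^{-h})$, $F^h=\sum_{i=1}^{n_h}f_i^h$, has a unique Nash equilibrium $\mathbf x^*\in\mathbb R^q$, i.e. a unique point with $F^h((\mathbf x^h)^*,(\mathbf x^{-h})^* )\le F^h(\mathbf x^h,(\mathbf x^{-h})^* )$ for all $\mathbf x^h\in\mathbb R^{q_h}$ and all $h$; it satisfies $\sum_{i=1}^{n_h}\nabla_{\mathbf x^h}f_i^h(\mathbf x^* )=\mathbf 0$ for all $h$. Moreover, there exists a step-size $\alpha>0$ such that for every initial $\mathbf x(0)$ the iterates of the algorithm with initialization $\mathbf y^h(0)=\mathbf G^h(0)$ satisfy $\lim_{k\to\infty}\mathbf x_i(k)=\mathbf x^*$ for all agents $i=1,\dots,n$ (so all agents reach consensus on $\mathbf x^*$), and the convergence is linear (geometric): there exist $C>0$ and $\rho\in(0,1)$ with $\|\mathbf x_i(k)-\mathbf x^*\|_2\le C\rho^k$ for all $i$ and $k$.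
   Context: Setting: $n$ agents partitioned into $H$ disjoint clusters, cluster $h$ containing $n_h$ agents, ordered so that cluster 1 comes first, then cluster 2, etc. Decision vector $\mathbf x=(\mathbf x^1,\dots,\mathbf x^H)\in\mathbb R^q$, $\mathbf x^h\in\mathbb R^{q_h}$, $q=\sum_hq_h$; $\mathbf x^{-h}$ denotes the components other than $\mathbf x^h$. The $i$-th agent of cluster $h$ has cost $f_i^h:\mathbb R^q\to\mathbb R$. (A1): for each $h$, $\mathbf C^h\in\mathbb R^{n_h\times n_h}$ is nonnegative, column-stochastic ($\mathbf 1^T\mathbf C^h=\mathbf 1^T$), with positive diagonal, and its directed graph (edge $j\to i$ iff $\mathbf C^h_{ij}>0$) is strongly connected. (A2): $\mathbf R\in\mathbb R^{n\times n}$ is nonnegative, row-stochastic ($\mathbf R\mathbf 1=\mathbf 1$), with positive diagonal and strongly connected directed graph. (A3): each $f_i^h$ is convex and continuously differentiable, and there is $L>0$ with $\|\nabla_{\mathbf x^h}f_i^h(\mathbf x)-\nabla_{\mathbf x^h}f_i^h(\tilde{\mathbf x})\|_2\le L\|\mathbf x-\tilde{\mathbf x}\|_2$ for all $\mathbf x,\tilde{\mathbf x}$ and all $i,h$. (A4): the game mapping $\mathbf M(\mathbf x)=(\mathbf g^1(\mathbf x),\dots,\mathbf g^H(\mathbf x))$, $\mathbf g^h(\mathbf x)=\sum_{i=1}^{n_h}\nabla_{\mathbf x^h}f_i^h(\mathbf x)$, is strongly monotone on $\mathbb R^q$ with constant $\mu>0$: $(\mathbf M(\mathbf x)-\mathbf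 M(\mathbf y))^T(\mathbf x-\mathbf y)\ge\mu\|\mathbf x-\mathbf y\|_2^2$. Algorithm (constant step-size $\alpha>0$): $\mathbf x(k)\in\mathbb R^{n\times q}$ has $i$-th row $\mathbf x_i(k)^T$ (agent $i$'s estimate of the whole decision vector); $\mathbf y^h(k)\in\mathbb R^{n_h\times q_h}$ (tracking variables of cluster $h$); $\mathbf Y(k)=\operatorname{diag}\{\mathbf y^1(k),\dots,\mathbf y^H(k)\}\in\mathbb R^{n\times q}$ (block diagonal); $\mathbf G^h(k)\in\mathbb R^{n_h\times q_h}$ has $i$-th row $\nabla_{\mathbf x^h}f_i^h(\mathbf x_i(k))^T$ ($\mathbf x_i(k)$ the estimate of the $i$-th agent of cluster $h$). Updates $\mathbf x(k+1)=\mathbf R(\mathbf x(k)-\alpha\mathbf Y(k))$, $\mathbf y^h(k+1)=\mathbf C^h\mathbf y^h(k)+\mathbf G^h(k+1)-\mathbf G^h(k)$, $k\ge0$. *)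

(* Defs.v *)
From HB Require Import structures.
From mathcomp Require Import all_boot all_order all_algebra.
From mathcomp Require Import all_classical all_reals all_analysis.
Set Implicit Arguments. Unset Strict Implicit. Unset Printing Implicit Defensive.
Import Order.TTheory GRing.Theory Num.Theory.
Import numFieldNormedType.Exports.
Local Open Scope ring_scope.

Section Defs.
Variable R : realType.

Definition dotr (m : nat) (u v : 'rV[R]_m) : R := \sum_(c < m) u 0 c * v 0 c.
Definition norm2 (m : nat) (v : 'rV[R]_m) : R := Num.sqrt (dotr v v).

Definition grad (q : nat) (f : 'rV[R]_q -> R) (x : 'rV[R]_q) : 'rV[R]_q :=
  \row_(c < q) ('D_(delta_mx 0 c) f x).

Definition convex_fun (q : nat) (f : 'rV[R]_q -> R) : Prop :=
  forall (x y : 'rV[R]_q) (t : R), 0 <= t <= 1 ->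
    f (t *: x + (1 - t) *: y) <= t * f x + (1 - t) * f y.

Definition C1_fun (q : nat) (f : 'rV[R]_q -> R) : Prop :=
  (forall x, differentiable f x) /\ continuous (grad f).

Definition strongly_connected (m : nat) (A : 'M[R]_m) : Prop :=
  forall i j : 'I_m, connect (fun a b : 'I_m => 0 < A b a) i j.

Definition nonneg_mx (m : nat) (A : 'M[R]_m) : Prop := forall i j, 0 <= A i j.
Definition pos_diag (m : nat) (A : 'M[R]_m) : Prop := forall i, 0 < A i i.
Definition col_stochastic (m : nat) (A : 'M[R]_m) : Prop :=
  forall j, \sum_(i < m) A i j = 1.
Definition row_stochastic (m : nat) (A : 'M[R]_m) : Prop :=
  forall i, \sum_(j < m) A i j = 1.

Variables (H : nat) (nh qh : 'I_H -> nat).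
Local Notation q := (\sum_(h < H) qh h)%N.
Local Notation n := (\sum_(h < H) nh h)%N.

Definition blk (x : 'rV[R]_q) (h : 'I_H) : 'rV[R]_(qh h) := submxrow x h.

Definition setblk (x : 'rV[R]_q) (h : 'I_H) (z : 'rV[R]_(qh h)) : 'rV[R]_q :=
  \mxrow_(j < H) match h =P j with
                 | ReflectT e => ecast j' 'rV[R]_(qh j') e z
                 | ReflectF _ => submxrow x j
                 end.

Definition blkdiag (y : forall h : 'I_H, 'M[R]_(nh h, qh h)) : 'M[R]_(n, q) :=
  \mxblock_(i < H, j < H) match i =P j with
                          | ReflectT e => ecast j' 'M[R]_(nh i, qh j') e (y i)
                          | ReflectF _ => 0
                          end.

Variable f : forall h : 'I_H, 'I_(nh h) -> 'rV[R]_q -> R.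

Definition Fcl (h : 'I_H) (x : 'rV[R]_q) : R := \sum_(i < nh h) f i x.

Definition gcl (h : 'I_H) (x : 'rV[R]_q) : 'rV[R]_(qh h) :=
  \sum_(i < nh h) blk (grad (f i) x) h.

Definition game_map (x : 'rV[R]_q) : 'rV[R]_q := \mxrow_(h < H) gcl h x.

Definition nash_eq (xs : 'rV[R]_q) : Prop :=
  forall (h : 'I_H) (z : 'rV[R]_(qh h)), Fcl h xs <= Fcl h (setblk xs z).

(* G^h(k) : i-th row is grad_{x^h} f_i^h(x_i)^T, where X stacks all estimates
   (agents of cluster h are the rows of block h of X) *)
Definition Gmat (h : 'I_H) (X : 'M[R]_(n, q)) : 'M[R]_(nh h, qh h) :=
  \matrix_(i < nh h, c < qh h) blk (grad (f i) (row i (submxcol X h))) h 0 c.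

End Defs.

(* Main.v *)
Require Import Defs.
From HB Require Import structures.
From mathcomp Require Import all_boot all_order all_algebra.
From mathcomp Require Import all_classical all_reals all_analysis.
From mathcomp Require Import ring lra.
Set Implicit Arguments. Unset Strict Implicit. Unset Printing Implicit Defensive.
Import Order.TTheory GRing.Theory Num.Theory.
Import numFieldNormedType.Exports.
Local Open Scope classical_set_scope.
Local Open Scope ring_scope.

(* Let r be the left Perron vector of R and p^h the right Perron vector of C^h.
   The algorithm is the preconditioned game iteration x -> x - alpha D M(x), with
   D = diag(w) and w = r^T diag(p^1, ..., p^H) > 0, perturbed by the consensus
   error X - 1 r^T X and the tracking error Y - diag(p^h 1^T y^h).  The weights
   differ from cluster to cluster, but strong monotonicity of M makes the
   iteration contract in the norm weighted by D^-1.
   Both averaging matrices contract, in one step and in Perron-weighted Euclidean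
   norms, on their invariant complements: the decrease of sum_i r_i v_i^2 is a sum
   of row variances, which the positive diagonal and strong connectivity bound
   from below.
   With E, N, S the squared weighted norms of the optimality, consensus and
   tracking errors, Young's inequality gives
     E' <= (1 - c alpha) E + alpha K (N + S),
     N' <= tau N + alpha K (E + N + S),
     S' <= tau S + K N + alpha K (E + N + S),
   and E + a N + b S decreases geometrically for suitable a, b and small alpha.
   The equilibrium is the zero of M: for convex costs the Nash condition is
   first-order, and x - t M(x) has an iterate contracting in the sup norm. *)

(** * Weighted sums of squares *)

Section WeightedSquares.
Variable R : realFieldType.

(** Lagrange's identity: twice the gap between the two sides is a double sum of squares with
    positive weights. *)
Lemma sum_CauchySchwarz (I : finType) (w a b : I -> R) : (forall i, 0 < w i) ->
  (\sum_i a i * b i) ^+ 2 <= (\sum_i b i ^+ 2 / w i) * (\sum_i w i * a i ^+ 2).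
Proof.
move=> w0.
have : 0 <= \sum_i \sum_j (w i * a i * b j - w j * a j * b i) ^+ 2 / (w i * w j).
  apply: sumr_ge0 => i _; apply: sumr_ge0 => j _.
  by rewrite mulr_ge0 ?sqr_ge0 // invr_ge0 mulr_ge0 // ltW.
have -> : \sum_i \sum_j (w i * a i * b j - w j * a j * b i) ^+ 2 / (w i * w j) =
    2 * ((\sum_i b i ^+ 2 / w i) * (\sum_i w i * a i ^+ 2) - (\sum_i a i * b i) ^+ 2).
  have E (u v : I -> R) : (\sum_i u i) * (\sum_i v i) = \sum_i \sum_j u i * v j.
    by rewrite mulr_suml; apply: eq_bigr => i _; rewrite mulr_sumr.
  rewrite mulrBr mulr2n mulrDl mul1r {2}[(\sum_i b i ^+ 2 / w i) * _]mulrC !E expr2 E.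
  rewrite mulr_sumr -big_split -sumrB; apply: eq_bigr => i _ /=.
  rewrite mulr_sumr -big_split -sumrB; apply: eq_bigr => j _ /=.
  by field; rewrite !gt_eqF.
lra.
Qed.

(** A squared Frobenius norm with one weight per entry, so that row weights (consensus error),
    column weights (optimality error) and cluster weights (tracking error) all fit one
    definition. *)
Definition wsq m n (W A : 'M[R]_(m, n)) : R := \sum_i \sum_j W i j * A i j ^+ 2.

Definition posmx m n (W : 'M[R]_(m, n)) : Prop := forall i j, 0 < W i j.

Section Fixed.
Variables (m n : nat) (W : 'M[R]_(m, n)) (W0 : posmx W).

Lemma wsq_ge0 (A : 'M[R]_(m, n)) : 0 <= wsq W A.
Proof.
apply: sumr_ge0 => i _; apply: sumr_ge0 => j _.
by rewrite mulr_ge0 ?sqr_ge0 // ltW.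
Qed.

Lemma wsqZ (a : R) (A : 'M[R]_(m, n)) : wsq W (a *: A) = a ^+ 2 * wsq W A.
Proof.
rewrite /wsq mulr_sumr; apply: eq_bigr => i _; rewrite mulr_sumr.
by apply: eq_bigr => j _; rewrite mxE; ring.
Qed.

Lemma wsqN (A : 'M[R]_(m, n)) : wsq W (- A) = wsq W A.
Proof. by rewrite -scaleN1r wsqZ sqrrN expr1n mul1r. Qed.

Lemma wsq_young (t : R) (A B : 'M[R]_(m, n)) : 0 < t ->
  wsq W (A + B) <= (1 + t) * wsq W A + (1 + t^-1) * wsq W B.
Proof.
move=> t0; rewrite /wsq !mulr_sumr -big_split; apply: ler_sum => i _ /=.
rewrite !mulr_sumr -big_split; apply: ler_sum => j _ /=; rewrite mxE.
have -> : (1 + t) * (W i j * A i j ^+ 2) + (1 + t^-1) * (W i j * B i j ^+ 2) =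
    W i j * (A i j + B i j) ^+ 2 + W i j * (t^-1 * (t * A i j - B i j) ^+ 2).
  by field; rewrite gt_eqF.
by rewrite lerDl mulr_ge0 ?(ltW (W0 i j)) // mulr_ge0 ?sqr_ge0 // invr_ge0 ltW.
Qed.

Lemma wsqD (A B : 'M[R]_(m, n)) :
  wsq W (A + B) <= 2 * wsq W A + 2 * wsq W B.
Proof.
by have := wsq_young A B (@ltr01 R); rewrite invr1.
Qed.

Lemma wsq_entry (A : 'M[R]_(m, n)) i j : W i j * A i j ^+ 2 <= wsq W A.
Proof.
have nonneg k l : 0 <= W k l * A k l ^+ 2 by rewrite mulr_ge0 ?sqr_ge0 // ltW.
rewrite /wsq (bigD1 i) //= (bigD1 j) //= -addrA lerDl addr_ge0 //.
  by apply: sumr_ge0.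
by apply: sumr_ge0 => k _; apply: sumr_ge0.
Qed.

(** Expand [A] over elementary matrices and apply Cauchy-Schwarz to each entry of the image.
    [wsq_equiv], [wsq_mulmx] and [wsq_mul_diag] are its instances. *)
Lemma wsq_linear_bound m' n' (W' : 'M[R]_(m', n'))
    (phi : {linear 'M[R]_(m, n) -> 'M[R]_(m', n')}) : posmx W' ->
  exists2 K, 0 < K & forall A, wsq W' (phi A) <= K * wsq W A.
Proof.
move=> W'0; pose c k l := \sum_i \sum_j phi (delta_mx i j) k l ^+ 2 / W i j.
have c0 k l : 0 <= c k l.
  apply: sumr_ge0 => i _; apply: sumr_ge0 => j _.
  by rewrite mulr_ge0 ?sqr_ge0 // invr_ge0 ltW.
exists (1 + \sum_k \sum_l W' k l * c k l).
  rewrite ltr_wpDr //; apply: sumr_ge0 => k _; apply: sumr_ge0 => l _.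
  by rewrite mulr_ge0 // ltW.
move=> A; apply: (@le_trans _ _ ((\sum_k \sum_l W' k l * c k l) * wsq W A)); last first.
  by rewrite ler_wpM2r ?wsq_ge0 // lerDr.
rewrite mulr_suml; apply: ler_sum => k _; rewrite mulr_suml; apply: ler_sum => l _.
rewrite -mulrA ler_wpM2l ?(ltW (W'0 k l)) //.
have -> : phi A k l = \sum_i \sum_j A i j * phi (delta_mx i j) k l.
  rewrite {1}[A]matrix_sum_delta linear_sum summxE; apply: eq_bigr => i _.
  by rewrite linear_sum summxE; apply: eq_bigr => j _; rewrite linearZ mxE.
rewrite /c /wsq !pair_bigA /=.
exact: (@sum_CauchySchwarz _ (fun p => W p.1 p.2) (fun p => A p.1 p.2)).
Qed.

End Fixed.
End WeightedSquares.

Section LinearImages.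
Variable R : realFieldType.
Implicit Types m n p : nat.

Lemma wsq_equiv m n (W W' : 'M[R]_(m, n)) : posmx W -> posmx W' ->
  exists2 K, 0 < K & forall A, wsq W' A <= K * wsq W A.
Proof. by move=> W0 W'0; exact: (wsq_linear_bound W0 idfun W'0). Qed.

Lemma wsq_mulmx m n p (W : 'M[R]_(m, n)) (W' : 'M[R]_(p, n)) (B : 'M[R]_(p, m)) :
  posmx W -> posmx W' ->
  exists2 K, 0 < K & forall A, wsq W' (B *m A) <= K * wsq W A.
Proof. by move=> W0 W'0; exact: (wsq_linear_bound W0 (mulmx B) W'0). Qed.

Lemma wsq_mul_diag n p (W : 'rV[R]_n) (W' : 'M[R]_(p, n)) (B : 'M[R]_(p, n)) :
  posmx W -> posmx W' ->
  exists2 K, 0 < K & forall v, wsq W' (B *m diag_mx v) <= K * wsq W v.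
Proof.
by move=> W0 W'0; exact: (wsq_linear_bound W0 (mulmx B \o @diag_mx R n) W'0).
Qed.

(** Young's inequality with [t = (1 - sg) / 2] costs at most half of the gap:
    [(1 + t) * sg <= (1 + sg) / 2], because [(1 - sg) ^+ 2 >= 0]. *)
Lemma wsq_contraction_perturb m n (W : 'M[R]_(m, n)) (sg : R) :
  posmx W -> 0 <= sg -> sg < 1 ->
  exists tau K : R, [/\ 0 <= tau, tau < 1, 0 < K & forall v (A B : 'M[R]_(m, n)),
    0 <= v -> wsq W A <= sg * v -> wsq W (A + B) <= tau * v + K * wsq W B].
Proof.
move=> W0 sg0 sg1; pose t := (1 - sg) / 2; have t0 : 0 < t by rewrite /t; lra.
exists ((1 + sg) / 2), (1 + t^-1); split; try lra.
  by rewrite addr_gt0 // invr_gt0.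
move=> v A B v0 HA; apply: (le_trans (wsq_young W0 A B t0)); rewrite lerD2r.
apply: (@le_trans _ _ ((1 + t) * (sg * v))).
  by rewrite ler_wpM2l // addr_ge0 // ltW.
rewrite mulrA ler_wpM2r // /t; nra.
Qed.

End LinearImages.

(** * Stochastic matrices *)

Section Stochastic.
Variables (R : realFieldType) (n : nat) (A : 'M[R]_n).
Hypothesis A_ge0 : forall i j, 0 <= A i j.
Hypothesis A_sum1 : forall i, \sum_j A i j = 1.
Hypothesis A_conn : forall i j, connect (fun a b => 0 < A b a) i j.

(** [A - 1] has a left null vector because the ones vector is a right one. Its entrywise absolute
    value is again stationary, and connectivity makes it positive. For [n = 0] nothing sums to 1,
    hence the guard on the normalization. *)
Lemma stationary_distribution :
  exists r : 'I_n -> R, [/\ forall i, 0 < r i,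
    forall j, \sum_i r i * A i j = r j & ((0 < n)%N -> \sum_i r i = 1)].
Proof.
have [n0|n_gt0] := posnP n.
  have no_index (i : 'I_n) : False by have := ltn_ord i; rewrite [X in (_ < X)%N]n0.
  by exists (fun=> 1); split=> [//|j|]; [case: (no_index j)|rewrite n0].
have /det0P[v v_neq0 vA] : \det (A - 1%:M) == 0.
  rewrite -det_tr; apply/det0P; exists (const_mx 1).
    apply/eqP => /matrixP/(_ 0 (Ordinal n_gt0)).
    by rewrite !mxE; apply/eqP; exact: oner_neq0.
  apply/rowP => i; rewrite !mxE.
  under eq_bigr do rewrite !mxE mul1r.
  rewrite sumrB A_sum1 (bigD1 i) //= eqxx big1 ?addr0 ?subrr // => j.
  by rewrite eq_sym => /negbTE ->.
have {}vA j : \sum_i v 0 i * A i j = v 0 j.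
  have /matrixP/(_ 0 j) : v *m A = v.
    by apply/eqP; rewrite -subr_eq0 -{2}[v]mulmx1 -mulmxBr vA.
  by rewrite mxE.
(* The triangle inequality gives [u <= u A] entrywise; the rows of [A] sum to 1, so both sides have
   the same total and equality holds. *)
pose u i := `|v 0 i|.
have u_le j : 0 <= \sum_i u i * A i j - u j.
  rewrite subr_ge0 /u -[in leLHS]vA (le_trans (ler_norm_sum _ _ _)) //.
  by apply: ler_sum => i _; rewrite normrM [`|A _ _|]ger0_norm.
have uA j : \sum_i u i * A i j = u j.
  have : \sum_j (\sum_i u i * A i j - u j) = 0.
    rewrite sumrB exchange_big /=; under eq_bigr do rewrite -mulr_sumr A_sum1 mulr1.
    by rewrite subrr.
  by move/psumr_eq0P => /(_ (fun j _ => u_le j) j isT)/eqP; rewrite subr_eq0 => /eqP.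
have u_ge0 i : 0 <= u i by exact: normr_ge0.
have u_gt0 j : 0 < u j.
  have [i ui] : exists i, 0 < u i.
    apply/existsP; apply: contraNT v_neq0; rewrite negb_exists => /forallP u0.
    apply/eqP/rowP => i; rewrite mxE; apply/eqP.
    by have := u0 i; rewrite -leNgt normr_le0.
  (* Stationarity carries positivity backwards along the path: [u j >= u x * A x j] for an edge from
     [j] to [x]. *)
  have /connectP[p] := A_conn j i.
  elim: p j => [j _ /= <- //|x p IH j /= /andP[Axj pth] last_i].
  rewrite -uA (lt_le_trans (mulr_gt0 (IH x pth last_i) Axj)) //.
  by rewrite (bigD1 x) //= lerDl; apply: sumr_ge0 => k _; rewrite mulr_ge0.
have U_gt0 : 0 < \sum_i u i.
  rewrite (bigD1 (Ordinal n_gt0)) //= ltr_pwDl //; exact: sumr_ge0.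
exists (fun i => u i / \sum_i u i); split=> [i|j|_].
- by rewrite divr_gt0.
- by rewrite -[in RHS]uA mulr_suml; apply: eq_bigr => i _; rewrite mulrAC.
- by rewrite -mulr_suml divff // gt_eqF.
Qed.

(** * Contraction of averaging in the stationary norm *)

Section Contraction.
Variable r : 'I_n -> R.
Hypothesis r_gt0 : forall i, 0 < r i.
Hypothesis rA : forall j, \sum_i r i * A i j = r j.
Hypothesis A_diag : forall i, 0 < A i i.

Let avg (v : 'I_n -> R) i := \sum_j A i j * v j.

Let dissipation (v : 'I_n -> R) := \sum_i \sum_j r i * A i j * (v j - avg v i) ^+ 2.

(** Stationarity spreads each [r j * v j ^+ 2] over the rows; each row then contributes its second
    moment minus its squared mean. *)
Lemma dissipationE v :
  dissipation v = \sum_i r i * v i ^+ 2 - \sum_i r i * avg v i ^+ 2.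
Proof.
have -> : \sum_i r i * v i ^+ 2 = \sum_i \sum_j r i * A i j * v j ^+ 2.
  by rewrite exchange_big; apply: eq_bigr => j _; rewrite -mulr_suml rA.
rewrite -sumrB; apply: eq_bigr => i _.
transitivity (\sum_j (r i * A i j * v j ^+ 2 - (2 * r i * avg v i) * (A i j * v j)
   + r i * avg v i ^+ 2 * A i j)).
  by apply: eq_bigr => j _; ring.
rewrite big_split sumrB -!mulr_sumr A_sum1 -/(avg v i) /=. ring.
Qed.

Lemma dissipation_ge0 v : 0 <= dissipation v.
Proof.
apply: sumr_ge0 => i _; apply: sumr_ge0 => j _.
by rewrite mulr_ge0 ?sqr_ge0 // mulr_ge0 // ltW.
Qed.

Lemma dissipation_term v i j : 0 < A i j ->
  (v j - avg v i) ^+ 2 <= (r i * A i j)^-1 * dissipation v.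
Proof.
move=> Aij; rewrite ler_pdivlMl ?mulr_gt0 //.
have nonneg k l : 0 <= r k * A k l * (v l - avg v k) ^+ 2.
  by rewrite mulr_ge0 ?sqr_ge0 // mulr_ge0 // ltW.
rewrite /dissipation (bigD1 i) //= (bigD1 j) //= -addrA lerDl addr_ge0 //.
  by apply: sumr_ge0.
by apply: sumr_ge0 => k _; apply: sumr_ge0.
Qed.

(* The positive diagonal makes i and every out-neighbour of i jointly sampled
   by row i, so their difference is controlled by the variance of that row;
   strong connectivity then chains these bounds along paths. *)
Lemma dissipation_diff i j :
  exists2 K, 0 <= K & forall v, (v i - v j) ^+ 2 <= K * dissipation v.
Proof.
have /connectP[p] := A_conn i j.
elim: p i => [i _ ->|x p IH i /= /andP[Axi pth] last_j].
  by exists 0 => // v; rewrite subrr expr0n mul0r.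
have [K K0 HK] := IH x pth last_j.
exists (4 * ((r x * A x x)^-1 + (r x * A x i)^-1) + 2 * K) => [|v].
  have inv_ge0 k : 0 <= (r x * A x k)^-1 by rewrite invr_ge0 mulr_ge0 // ltW.
  by rewrite addr_ge0 // mulr_ge0 // addr_ge0.
have H1 := dissipation_term v (A_diag x); have H2 := dissipation_term v Axi.
have H3 := HK v.
have H4 : (v i - v j) ^+ 2 <= 4 * ((v x - avg v x) ^+ 2 + (v i - avg v x) ^+ 2)
    + 2 * (v x - v j) ^+ 2.
  have := sqr_ge0 ((v i - v x) - (v x - v j)).
  have := sqr_ge0 ((v x - avg v x) + (v i - avg v x)).
  nra.
by apply: (le_trans H4); lra.
Qed.

(** A Poincare inequality: for zero [r]-mean, twice the squared norm is the double sum of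
    [r i * r j * (v i - v j) ^+ 2], which [dissipation_diff] bounds by the decrease of the norm. *)
Lemma averaging_contraction : \sum_i r i = 1 -> exists sg : R, [/\ 0 <= sg, sg < 1 &
  forall v : 'I_n -> R, \sum_i r i * v i = 0 ->
    \sum_i r i * (\sum_j A i j * v j) ^+ 2 <= sg * \sum_i r i * v i ^+ 2].
Proof.
move=> r1.
have [K HK] : exists K : 'I_n -> 'I_n -> R, forall i j, 0 <= K i j /\
    forall v, (v i - v j) ^+ 2 <= K i j * dissipation v.
  have H i j : exists K, 0 <= K /\ forall v, (v i - v j) ^+ 2 <= K * dissipation v.
    by have [K] := dissipation_diff i j; exists K.
  have H' i := fin_all_exists (H i).
  exact: fin_all_exists H'.
(* The leading 1 gives [1 <= k], so the factor [1 - k^-1] is nonnegative. *)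
pose k := 1 + \sum_i \sum_j r i * r j * K i j.
have k1 : 1 <= k.
  rewrite lerDl; apply: sumr_ge0 => i _; apply: sumr_ge0 => j _.
  by rewrite !mulr_ge0 ?(HK _ _).1 // ltW.
have k0 : 0 < k by apply: lt_le_trans k1.
exists (1 - k^-1); split=> [||v v0].
- by rewrite subr_ge0 invf_le1.
- by rewrite gtrBl invr_gt0.
have -> : \sum_i r i * (\sum_j A i j * v j) ^+ 2 =
    \sum_i r i * v i ^+ 2 - dissipation v by rewrite dissipationE; ring.
suff H : \sum_i r i * v i ^+ 2 <= k * dissipation v.
  rewrite mulrBl mul1r lerD2l lerN2 ler_pdivrMl //.
have E : \sum_i \sum_j r i * r j * (v i - v j) ^+ 2 = 2 * \sum_i r i * v i ^+ 2.
  transitivity (\sum_i ((r i * v i ^+ 2) * (\sum_j r j) - (2 * r i * v i) * (\sum_j r j * v j)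
      + r i * (\sum_j r j * v j ^+ 2))).
    apply: eq_bigr => i _; rewrite !mulr_sumr -sumrB -big_split.
    by apply: eq_bigr => j _ /=; ring.
  rewrite r1 v0; under eq_bigr do rewrite mulr1 mulr0 subr0.
  by rewrite big_split -mulr_suml r1 /=; ring.
have F : \sum_i \sum_j r i * r j * (v i - v j) ^+ 2 <= (k - 1) * dissipation v.
  rewrite /k addrAC subrr add0r mulr_suml; apply: ler_sum => i _.
  rewrite mulr_suml; apply: ler_sum => j _.
  by rewrite -[_ * K i j * _]mulrA ler_wpM2l ?(HK _ _).2 // mulr_ge0 // ltW.
have S0 : 0 <= \sum_i r i * v i ^+ 2.
  by apply: sumr_ge0 => i _; rewrite mulr_ge0 ?sqr_ge0 // ltW.
have := dissipation_ge0 v; lra.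
Qed.

End Contraction.
End Stochastic.

(* In the variables v i = y i / p i the column-stochastic matrix becomes
   row-stochastic with the same stationary distribution p. *)
Lemma column_stochastic_contraction (R : realFieldType) (n : nat) (C : 'M[R]_n) :
  (forall i j, 0 <= C i j) -> (forall j, \sum_i C i j = 1) ->
  (forall i, 0 < C i i) -> (forall i j, connect (fun a b => 0 < C b a) i j) ->
  exists (p : 'I_n -> R) (sg : R), [/\ forall i, 0 < p i,
    forall i, \sum_j C i j * p j = p i, ((0 < n)%N -> \sum_i p i = 1),
    0 <= sg < 1 & forall y : 'I_n -> R, \sum_i y i = 0 ->
      \sum_i (p i)^-1 * (\sum_j C i j * y j) ^+ 2 <= sg * \sum_i (p i)^-1 * y i ^+ 2].
Proof.
move=> C0 C1 Cd Cc.
have [p [p0 pC p1]] : exists p : 'I_n -> R, [/\ forall i, 0 < p i,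
    forall i, \sum_j C i j * p j = p i & ((0 < n)%N -> \sum_i p i = 1)].
  have [|||p [p0 pC p1]] := @stationary_distribution R n C^T.
  - by move=> i j; rewrite mxE.
  - by move=> i; under eq_bigr do rewrite mxE.
  - move=> i j; have := Cc j i.
    have /= <- := connect_rev (fun a b => 0 < C b a) i j.
    by apply: etrans; apply: eq_connect => a b /=; rewrite mxE.
  - exists p; split=> // i; rewrite -[RHS]pC; apply: eq_bigr => j _.
    by rewrite mxE mulrC.
have [n0|n_gt0] := posnP n.
  exists p, 0; split; rewrite ?lexx ?ltr01 //.
  move=> y _; rewrite mul0r big1 // => i.
  by exfalso; have := ltn_ord i; rewrite [X in (_ < X)%N]n0.
pose A : 'M[R]_n := \matrix_(i, j) (C i j * p j / p i).
have p_neq0 i : p i != 0 by rewrite gt_eqF.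
have [|||||sg [sg0 sg1 Hsg]] := @averaging_contraction R n A _ _ _ p p0 _ _ (p1 n_gt0).
- by move=> i j; rewrite mxE divr_ge0 ?mulr_ge0 // ltW.
- by move=> i; under eq_bigr do rewrite mxE; rewrite -mulr_suml pC divff.
- move=> i j; apply: etrans (Cc i j); apply: eq_connect => a b.
  by rewrite mxE -mulrA pmulr_lgt0 // divr_gt0.
- move=> j; rewrite -[RHS]mul1r -(C1 j) mulr_suml; apply: eq_bigr => i _.
  by rewrite mxE; field.
- by move=> i; rewrite mxE divr_gt0 // mulr_gt0.
exists p, sg; split=> //; [by move=> _; exact: p1|by rewrite sg0|].
move=> y y0; have := Hsg (fun i => y i / p i).
have -> : \sum_i p i * (y i / p i) = 0.
  by rewrite -[RHS]y0; apply: eq_bigr => i _; rewrite mulrCA divff // mulr1.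
move=> /(_ erefl).
have -> : \sum_i p i * (\sum_j A i j * (y j / p j)) ^+ 2 =
    \sum_i (p i)^-1 * (\sum_j C i j * y j) ^+ 2.
  apply: eq_bigr => i _.
  have -> : \sum_j A i j * (y j / p j) = (p i)^-1 * \sum_j C i j * y j.
    by rewrite mulr_sumr; apply: eq_bigr => j _; rewrite mxE; field; rewrite !p_neq0.
  by field.
have -> : \sum_i p i * (y i / p i) ^+ 2 = \sum_i (p i)^-1 * y i ^+ 2.
  by apply: eq_bigr => i _; field.
by [].
Qed.

(** The term [K * N] in the bound on [S'] carries no factor [alpha], so the weights are chosen in
    cascade: [a] small against [c], [b] small against [a], then [alpha] small against [b]. *)
Lemma coupled_contraction (R : realFieldType) (c K tau : R) :
  0 < c -> 1 <= K -> 0 <= tau -> tau < 1 ->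
  exists a b alpha1 : R, [/\ 0 < a, 0 < b, 0 < alpha1 &
    forall alpha, 0 < alpha -> alpha <= alpha1 ->
    exists rho : R, [/\ 0 < rho, rho < 1 & forall E N S E' N' S' : R,
      0 <= E -> 0 <= N -> 0 <= S ->
      E' <= (1 - c * alpha) * E + alpha * K * (N + S) ->
      N' <= tau * N + alpha * K * (E + N + S) ->
      S' <= tau * S + K * N + alpha * K * (E + N + S) ->
      E' + a * N' + b * S' <= rho * (E + a * N + b * S)]].
Proof.
move=> c0 K1 tau0 tau1; have K0 : 0 < K by lra.
have t0 : 0 < 1 - tau by lra.
have K4 : 0 < 4 * K by lra.
pose a := c / (4 * K); have a0 : 0 < a by exact: divr_gt0.
pose b := a * (1 - tau) / (4 * K).
have b0 : 0 < b by apply: divr_gt0 => //; exact: mulr_gt0.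
have aK : a * K = c / 4 by rewrite /a; field; rewrite gt_eqF.
have bK : b * K = a * (1 - tau) / 4 by rewrite /b; field; rewrite gt_eqF.
have ba : b <= a by nra.
clearbody b; clearbody a.
pose Q := K * (1 + a + b); have Q0 : 0 < Q by rewrite mulr_gt0 // addr_gt0 // addr_gt0.
exists a, b, (b * (1 - tau) / (4 * Q)); split=> //.
  by rewrite divr_gt0 // mulr_gt0.
move=> alpha al0; rewrite ler_pdivlMr ?(mulr_gt0 _ Q0) // => al1.
have {}al1 : alpha * Q <= b * (1 - tau) / 4 by lra.
(* Half of the decrease [c * alpha] of [E] and half of the gap [1 - tau] of [N] and [S] survive the
   coupling; the slower rate is kept. *)
exists (Num.max (1 - c * alpha / 2) ((1 + tau) / 2)); set rho := Num.max _ _.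
have rho1 : 1 - c * alpha / 2 <= rho by rewrite le_max lexx.
have rho2 : (1 + tau) / 2 <= rho by rewrite le_max lexx orbT.
split; first by lra.
  by rewrite gt_max; apply/andP; split; [nra|lra].
move=> E N S E' N' S' E0 N0 S0 HE HN HS.
have cE : 1 - c * alpha + (a + b) * (alpha * K) <= rho.
  apply: le_trans rho1.
  have : (a + b) * (alpha * K) <= alpha * (c / 2).
    have -> : (a + b) * (alpha * K) = alpha * ((a + b) * K) by ring.
    by rewrite ler_pM2l // mulrDl; nra.
  by lra.
have cN : alpha * Q + a * tau + b * K <= rho * a by nra.
have cS : alpha * Q + b * tau <= rho * b by nra.
apply: (@le_trans _ _ (((1 - c * alpha) * E + alpha * K * (N + S)) +
  a * (tau * N + alpha * K * (E + N + S)) +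
  b * (tau * S + K * N + alpha * K * (E + N + S)))).
  by apply: lerD; [apply: lerD => //|]; rewrite ler_pM2l.
have -> : ((1 - c * alpha) * E + alpha * K * (N + S)) +
  a * (tau * N + alpha * K * (E + N + S)) +
  b * (tau * S + K * N + alpha * K * (E + N + S)) =
  (1 - c * alpha + (a + b) * (alpha * K)) * E + (alpha * Q + a * tau + b * K) * N
  + (alpha * Q + b * tau) * S by rewrite /Q; ring.
have -> : rho * (E + a * N + b * S) = rho * E + rho * a * N + rho * b * S by ring.
by apply: lerD; [apply: lerD|]; apply: ler_wpM2r.
Qed.

(** * Gradient tracking with stacked variables *)

Section Tracking.
Variables (R : realFieldType) (n q : nat).
Variables (A C : 'M[R]_n) (r : 'rV[R]_n) (P Wc : 'M[R]_(n, q)).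
Variable supp : 'I_n -> 'I_q -> bool.
Variable G : 'M[R]_(n, q) -> 'M[R]_(n, q).
Variables (xs : 'rV[R]_q) (sgA sgC L mu : R).

Let one : 'cV[R]_n := const_mx 1.
Let uno : 'rV[R]_n := const_mx 1.
Let sq m p (M : 'M[R]_(m, p)) := wsq (const_mx 1) M.
Let game x := uno *m G (one *m x).
Let Wr : 'M[R]_(n, q) := \matrix_(i, j) r 0 i.
(** The diagonal of the preconditioner [D]: coordinate [j] of the mean moves with effective step
    [alpha * w 0 j]. *)
Let w := r *m P.
Let We : 'rV[R]_q := \row_j (w 0 j)^-1.
(** In the application [supp] marks the diagonal blocks. A supported matrix with zero column sums
    has zero sums inside each cluster, as the contraction of a block-diagonal [C] requires. *)
Let supported (M : 'M[R]_(n, q)) := forall i j, ~~ supp i j -> M i j = 0.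

Hypothesis r_gt0 : posmx r.
Hypothesis rA : r *m A = r.
Hypothesis A_one : A *m one = one.
Hypothesis r_one : r *m one = 1%:M.
Hypothesis sgA0 : 0 <= sgA.
Hypothesis sgA1 : sgA < 1.
Hypothesis A_contr : forall V : 'M[R]_(n, q), r *m V = 0 ->
  wsq Wr (A *m V) <= sgA * wsq Wr V.
Hypothesis uno_C : uno *m C = uno.
Hypothesis C_P : C *m P = P.
Hypothesis uno_P : uno *m P = const_mx 1.
Hypothesis P_supp : supported P.
Hypothesis w_gt0 : posmx w.
Hypothesis Wc_gt0 : posmx Wc.
Hypothesis sgC0 : 0 <= sgC.
Hypothesis sgC1 : sgC < 1.
Hypothesis C_contr : forall V : 'M[R]_(n, q), supported V -> uno *m V = 0 ->
  wsq Wc (C *m V) <= sgC * wsq Wc V.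
Hypothesis L_gt0 : 0 < L.
Hypothesis G_lip : forall X X', sq (G X - G X') <= L * sq (X - X').
Hypothesis mu_gt0 : 0 < mu.
Hypothesis game_mono : forall x y,
  mu * sq (x - y) <= \sum_j (game x - game y) 0 j * (x - y) 0 j.
Hypothesis game_xs : game xs = 0.

Let mean (X : 'M[R]_(n, q)) := r *m X.
Let dev X := X - one *m mean X.
(** The subtracted part redistributes the column sums of [Y] along the Perron vectors. It is fixed
    by [C] and has the same column sums as [Y], so the remainder has column sums zero. *)
Let track (Y : 'M[R]_(n, q)) := Y - P *m diag_mx (uno *m Y).

Let errE X := wsq We (mean X - xs).
Let errN X := wsq Wr (dev X).
Let errS Y := wsq Wc (track Y).
Let err X Y := errE X + errN X + errS Y.

Let one_gt0 m p : posmx (const_mx 1 : 'M[R]_(m, p)).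
Proof. by move=> i j; rewrite mxE. Qed.

Let Wr_gt0 : posmx Wr. Proof. by move=> i j; rewrite mxE. Qed.

Let We_gt0 : posmx We. Proof. by move=> i j; rewrite mxE invr_gt0. Qed.

Let errE_ge0 X : 0 <= errE X. Proof. exact: wsq_ge0. Qed.
Let errN_ge0 X : 0 <= errN X. Proof. exact: wsq_ge0. Qed.
Let errS_ge0 Y : 0 <= errS Y. Proof. exact: wsq_ge0. Qed.

Let sq_ge0 m p (M : 'M[R]_(m, p)) : 0 <= sq M.
Proof. exact: wsq_ge0 (@one_gt0 m p) M. Qed.

Lemma game_lip : exists2 K, 0 < K & forall x y, sq (game x - game y) <= K * sq (x - y).
Proof.
have [K1 K10 H1] := wsq_mulmx uno (@one_gt0 n q) (@one_gt0 1 q).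
have [K2 K20 H2] := wsq_mulmx one (@one_gt0 1 q) (@one_gt0 n q).
exists (K1 * (L * K2)) => [|x y]; first by rewrite !mulr_gt0.
rewrite /game -mulmxBr (le_trans (H1 _)) // -mulrA ler_pM2l //.
rewrite (le_trans (G_lip _ _)) // -mulrA ler_pM2l //.
by rewrite -mulmxBr; exact: H2.
Qed.

(** The arguments of [G] on the two sides differ by exactly [dev X], so the Lipschitz bound
    applies. *)
Lemma gradient_sum_error : exists2 K, 0 < K & forall X,
  sq (uno *m G X - game (mean X)) <= K * errN X.
Proof.
have [K1 K10 H1] := wsq_mulmx uno (@one_gt0 n q) (@one_gt0 1 q).
have [K2 K20 H2] := wsq_equiv Wr_gt0 (@one_gt0 n q).
exists (K1 * (L * K2)) => [|X]; first by rewrite !mulr_gt0.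
rewrite /game -mulmxBr (le_trans (H1 _)) // -mulrA ler_pM2l //.
by rewrite (le_trans (G_lip _ _)) // -mulrA ler_pM2l //; exact: H2.
Qed.

(** Besides its tracking error, [Y] consists of the redistributed sum [uno *m G X], which vanishes
    when every row of [X] is [xs]. Terms of size [alpha *: Y] thus count as perturbations by the
    errors themselves. *)
Lemma tracker_bound : exists2 K, 0 < K & forall X Y, uno *m Y = uno *m G X ->
  sq Y <= K * err X Y.
Proof.
have [K1 K10 H1] := gradient_sum_error.
have [K2 K20 H2] := game_lip.
have [K3 K30 H3] := wsq_equiv We_gt0 (@one_gt0 1 q).
have [K4 K40 H4] := wsq_equiv Wc_gt0 (@one_gt0 n q).
have [K5 K50 H5] := wsq_mul_diag P (@one_gt0 1 q) (@one_gt0 n q).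
exists (2 * K4 + 2 * K5 * (2 * K1 + 2 * (K2 * K3))) => [|X Y YG].
  by rewrite !(addr_gt0, mulr_gt0).
rewrite /sq -{1}[Y](subrK (P *m diag_mx (uno *m Y))) -/(track Y) (le_trans (wsqD (@one_gt0 n q) _ _)) //.
rewrite [leRHS]mulrDl; apply: lerD.
  rewrite -mulrA ler_pM2l // (le_trans (H4 _)) // ler_pM2l // /err.
  by rewrite lerDr addr_ge0.
rewrite -!mulrA ler_pM2l // (le_trans (H5 _)) // ler_pM2l // YG.
have -> : uno *m G X = (uno *m G X - game (mean X)) + (game (mean X) - game xs).
  by rewrite game_xs subr0 subrK.
rewrite (le_trans (wsqD (@one_gt0 1 q) _ _)) // [leRHS]mulrDl.
have E1 := H1 X; have E2 := H2 (mean X) xs; have E3 := H3 (mean X - xs).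
have errN_le : errN X <= err X Y by rewrite /err; have := errE_ge0 X; have := errS_ge0 Y; lra.
have errE_le : errE X <= err X Y by rewrite /err; have := errN_ge0 X; have := errS_ge0 Y; lra.
apply: lerD; rewrite -!mulrA ler_pM2l //.
  by rewrite (le_trans E1) // ler_pM2l.
rewrite (le_trans E2) // ler_pM2l // (le_trans E3) // ler_pM2l //.
Qed.

(** * One step of the algorithm in error coordinates *)

Section Step.
Variables (X Y X' Y' : 'M[R]_(n, q)) (alpha : R).
Hypothesis X'E : X' = A *m (X - alpha *: Y).
Hypothesis Y'E : Y' = C *m Y + G X' - G X.
Hypothesis YG : uno *m Y = uno *m G X.

(** The tracking invariant: [C] preserves column sums, so the gradient increments telescope. *)
Lemma sum_track_step : uno *m Y' = uno *m G X'.
Proof.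
by rewrite Y'E mulmxBr mulmxDr mulmxA uno_C YG addrAC subrr add0r.
Qed.

Lemma mean_step : mean X' = mean X - alpha *: (r *m Y).
Proof. by rewrite /mean X'E mulmxA rA mulmxBr -scalemxAr. Qed.

Lemma dev_step : dev X' = A *m dev X + (- alpha) *: (A *m Y - one *m (r *m Y)).
Proof.
have AE : A *m dev X = A *m X - one *m mean X.
  by rewrite /dev mulmxBr mulmxA A_one.
rewrite AE {1}/dev mean_step X'E [A *m (_ - _)]mulmxBr [one *m (_ - _ *: _)]mulmxBr -!scalemxAr.
move: (A *m X) (A *m Y) (one *m _) (one *m _) => a b d e.
by apply/matrixP => i j; rewrite !mxE; ring.
Qed.

Lemma track_step : track Y' = C *m track Y +
  ((G X' - G X) - P *m diag_mx (uno *m (G X' - G X))).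
Proof.
have CE : C *m track Y = C *m Y - P *m diag_mx (uno *m G X).
  by rewrite /track mulmxBr mulmxA C_P YG.
have PE : P *m diag_mx (uno *m (G X' - G X)) =
    P *m diag_mx (uno *m G X') - P *m diag_mx (uno *m G X).
  by rewrite mulmxBr raddfB mulmxBr.
rewrite CE PE /track sum_track_step Y'E.
move: (G X) (G X') (C *m Y) (P *m _) (P *m _) => a b c d e.
by apply/matrixP => i j; rewrite !mxE; ring.
Qed.

(** Splits the direction of the mean into the [w]-weighted gradient sum and an error linear in
    [track Y]. *)
Lemma mean_tracker : r *m Y = r *m track Y + w *m diag_mx (uno *m Y).
Proof. by rewrite /track mulmxBr mulmxA -/w subrK. Qed.

End Step.

(** In the norm weighted by the inverse of [w], the cross term of the step is the plain inner
    product of [M] and [e]; strong monotonicity applies although [w] varies between coordinates. *)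
Lemma mean_error_step : exists c K alpha1 : R, [/\ 0 < c, 0 < K, 0 < alpha1 &
  forall X Y alpha, 0 < alpha -> alpha <= alpha1 -> uno *m Y = uno *m G X ->
    wsq We (mean X - alpha *: (r *m Y) - xs) <=
      (1 - c * alpha) * errE X + alpha * K * (errN X + errS Y)].
Proof.
have [K1 K10 H1] := game_lip.
have [K2 K20 H2] := wsq_equiv (@one_gt0 1 q) w_gt0.
have [K3 K30 H3] := wsq_equiv (@one_gt0 1 q) We_gt0.
have [K4 K40 H4] := gradient_sum_error.
have [K5 K50 H5] := wsq_mul_diag w (@one_gt0 1 q) We_gt0.
have [K6 K60 H6] := wsq_mulmx r Wc_gt0 We_gt0.
(* Chosen so that [mu * sq e] dominates [2 * c * errE X]; one [c * alpha] of the resulting decrease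
   pays for Young's inequality. *)
pose c := mu / (2 * K3); have c0 : 0 < c by rewrite divr_gt0 // mulr_gt0.
have cK3 : 2 * c * K3 = mu by rewrite /c; field; rewrite gt_eqF.
have c1 : 0 < 1 + c^-1 by rewrite addr_gt0 // invr_gt0.
(* Below [mu / (K2 * K1)], half of the monotonicity gain absorbs the quadratic term; below 1,
   [alpha + c^-1] is at most [1 + c^-1]. *)
pose a1 := Num.min 1 (mu / (K2 * K1)).
pose Kz := 2 * K6 + 2 * (K5 * K4); have Kz0 : 0 < Kz by rewrite !(addr_gt0, mulr_gt0).
exists c, ((1 + c^-1) * Kz), a1; split=> //.
- by rewrite mulr_gt0.
- by rewrite lt_min ltr01 divr_gt0 // mulr_gt0.
move=> X Y alpha al0; rewrite le_min => /andP[al1 al2] YG.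
pose e := mean X - xs; pose M := game (mean X).
pose z := r *m track Y + w *m diag_mx (uno *m Y - M).
have -> : mean X - alpha *: (r *m Y) - xs =
    (e - alpha *: (w *m diag_mx M)) + (- alpha) *: z.
  rewrite mean_tracker /z /e (raddfB (@diag_mx R q)) (mulmxBr w).
  move: (w *m _) (w *m _) (r *m _) => a b d.
  by apply/matrixP => i j; rewrite !mxE; ring.
have z_le : wsq We z <= Kz * (errN X + errS Y).
  rewrite (le_trans (wsqD We_gt0 _ _)) //.
  have F1 := H6 (track Y); have F2 := H5 (uno *m Y - M).
  have F3 := H4 X; rewrite -YG -/M in F3.
  have F4 : K5 * sq (uno *m Y - M) <= K5 * (K4 * errN X) by rewrite ler_pM2l.
  have F5 := errN_ge0 X; have F6 := errS_ge0 Y.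
  have F7 : 0 <= K6 * errN X by rewrite mulr_ge0 // ltW.
  have F8 : 0 <= K5 * K4 * errS Y by rewrite mulr_ge0 // mulr_ge0 // ltW.
  by rewrite /Kz; rewrite -/(sq (uno *m Y - M)) -/(errS Y) in F1 F2 *; lra.
have u_le : wsq We (e - alpha *: (w *m diag_mx M)) <= (1 - 2 * c * alpha) * errE X.
  have -> : wsq We (e - alpha *: (w *m diag_mx M)) =
      errE X - 2 * alpha * \sum_j M 0 j * e 0 j + alpha ^+ 2 * wsq w M.
    rewrite /errE /wsq !big_ord1 -/e !mulr_sumr -sumrB -big_split.
    apply: eq_bigr => j _ /=; rewrite mul_mx_diag !mxE.
    by field; have := w_gt0 0 j; rewrite /w mxE => /lt0r_neq0.
  have F1 := game_mono (mean X) xs; rewrite game_xs subr0 -/M -/e in F1.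
  have F2 := H1 (mean X) xs; rewrite game_xs subr0 -/M -/e in F2.
  have F3 := H2 M; have F4 := H3 e; rewrite -/(errE X) in F4.
  have F5 : wsq w M <= K2 * K1 * sq e.
    by rewrite (le_trans F3) // -mulrA ler_pM2l.
  have F6 : alpha ^+ 2 * wsq w M <= alpha * (mu * sq e).
    rewrite expr2 -mulrA ler_pM2l //.
    rewrite (le_trans (y := alpha * (K2 * K1 * sq e))) ?ler_pM2l // mulrA.
    by rewrite ler_wpM2r // -ler_pdivlMr // mulr_gt0.
  have F7 : alpha * (mu * sq e) <= alpha * \sum_j M 0 j * e 0 j by rewrite ler_pM2l.
  have F8 : 2 * c * errE X <= mu * sq e.
    by rewrite -cK3 -[_ * K3 * _]mulrA ler_pM2l // mulr_gt0.
  have F9 : alpha * (2 * c * errE X) <= alpha * (mu * sq e) by rewrite ler_pM2l.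
  by lra.
(* With Young parameter [c * alpha] the perturbation costs about [alpha ^+ 2 / (c * alpha)], which
   is still of order [alpha]. *)
have ca0 : 0 < c * alpha by rewrite mulr_gt0.
apply: (le_trans (wsq_young We_gt0 _ _ ca0)); apply: lerD.
  apply: (@le_trans _ _ ((1 + c * alpha) * ((1 - 2 * c * alpha) * errE X))).
    by rewrite ler_pM2l // addr_gt0.
  rewrite mulrA ler_wpM2r //; nra.
rewrite wsqZ sqrrN.
have -> : (1 + (c * alpha)^-1) * (alpha ^+ 2 * wsq We z) = alpha * ((alpha + c^-1) * wsq We z).
  by field; rewrite !gt_eqF.
rewrite -!mulrA ler_pM2l //.
apply: (@le_trans _ _ ((1 + c^-1) * wsq We z)).
  by rewrite ler_wpM2r ?wsq_ge0 // lerD2r.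
by rewrite ler_pM2l.
Qed.

Lemma consensus_step : exists tau K : R, [/\ 0 <= tau, tau < 1, 0 < K &
  forall X Y alpha, 0 < alpha -> alpha <= 1 -> uno *m Y = uno *m G X ->
    wsq Wr (A *m dev X + (- alpha) *: (A *m Y - one *m (r *m Y))) <=
      tau * errN X + alpha * K * err X Y].
Proof.
have [tau [K1 [tau0 tau1 K10 H1]]] := wsq_contraction_perturb Wr_gt0 sgA0 sgA1.
have [K2 K20 H2] := wsq_mulmx (A - one *m r) (@one_gt0 n q) Wr_gt0.
have [K3 K30 H3] := tracker_bound.
exists tau, (K1 * (K2 * K3)); split=> //; first by rewrite !mulr_gt0.
move=> X Y alpha al0 al1 YG.
have dev0 : r *m dev X = 0 by rewrite /dev mulmxBr mulmxA r_one mul1mx subrr.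
apply: (le_trans (H1 _ _ _ (errN_ge0 X) (A_contr dev0))); rewrite lerD2l.
have -> : A *m Y - one *m (r *m Y) = (A - one *m r) *m Y by rewrite mulmxBl mulmxA.
rewrite wsqZ sqrrN.
have F1 := le_trans (H2 Y) (ler_wpM2l (ltW K20) (H3 X Y YG)).
have F2 := wsq_ge0 Wr_gt0 ((A - one *m r) *m Y).
have F3 : alpha ^+ 2 * wsq Wr ((A - one *m r) *m Y) <= alpha * (K2 * (K3 * err X Y)).
  by rewrite expr2 -mulrA ler_pM2l //; nra.
have F4 : K1 * (alpha ^+ 2 * wsq Wr ((A - one *m r) *m Y)) <=
  K1 * (alpha * (K2 * (K3 * err X Y))) by rewrite ler_pM2l.
by lra.
Qed.

(** [D] stands for the gradient increment, whose size is estimated through [increment_bound]. *)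
Lemma tracking_step : exists tau K : R, [/\ 0 <= tau, tau < 1, 0 < K &
  forall Y D, supported Y ->
    wsq Wc (C *m track Y + (D - P *m diag_mx (uno *m D))) <= tau * errS Y + K * sq D].
Proof.
have [tau [K1 [tau0 tau1 K10 H1]]] := wsq_contraction_perturb Wc_gt0 sgC0 sgC1.
have [K2 K20 H2] := wsq_equiv (@one_gt0 n q) Wc_gt0.
have [K3 K30 H3] := wsq_mul_diag P (@one_gt0 1 q) Wc_gt0.
have [K4 K40 H4] := wsq_mulmx uno (@one_gt0 n q) (@one_gt0 1 q).
exists tau, (K1 * (2 * K2 + 2 * (K3 * K4))); split=> //.
  by rewrite mulr_gt0 // !(addr_gt0, mulr_gt0).
move=> Y D Ys.
have tr0 : uno *m track Y = 0.
  rewrite /track mulmxBr mulmxA uno_P; apply/rowP => j.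
  by rewrite [LHS]mxE mul_mx_diag !mxE mul1r subrr.
have trs : supported (track Y).
  by move=> i j ns; rewrite /track mul_mx_diag !mxE Ys // P_supp // mul0r subrr.
apply: (le_trans (H1 _ _ _ (errS_ge0 Y) (C_contr trs tr0))); rewrite lerD2l -mulrA ler_pM2l //.
rewrite (le_trans (wsqD Wc_gt0 _ _)) // wsqN.
have F1 := H2 D; have F2 := H3 (uno *m D).
have F3 : K3 * sq (uno *m D) <= K3 * (K4 * sq D) by rewrite ler_pM2l //; exact: H4.
by rewrite -/(sq D) -/(sq (uno *m D)) in F1 F2 *; lra.
Qed.

(** [A - 1] kills consensus vectors, so [X] enters only through [dev X]. The term [K * errN X]
    without [alpha] is the source of the coupling [K * N]. *)
Lemma increment_bound : exists2 K, 0 < K & forall X Y alpha,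
  0 < alpha -> alpha <= 1 -> uno *m Y = uno *m G X ->
  sq (A *m (X - alpha *: Y) - X) <= K * errN X + alpha * K * err X Y.
Proof.
have [K1 K10 H1] := wsq_mulmx (A - 1%:M) Wr_gt0 (@one_gt0 n q).
have [K2 K20 H2] := wsq_mulmx A (@one_gt0 n q) (@one_gt0 n q).
have [K3 K30 H3] := tracker_bound.
exists (2 * K1 + 2 * (K2 * K3)) => [|X Y alpha al0 al1 YG].
  by rewrite !(addr_gt0, mulr_gt0).
have -> : A *m (X - alpha *: Y) - X = (A - 1%:M) *m dev X + (- alpha) *: (A *m Y).
  rewrite /dev mulmxBl mul1mx !mulmxBr mulmxA A_one -scalemxAr.
  by move: (A *m X) (A *m Y) (one *m _) => a b d; apply/matrixP => i j; rewrite !mxE; ring.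
rewrite /sq (le_trans (wsqD (@one_gt0 n q) _ _)) // wsqZ sqrrN.
have F1 := H1 (dev X); rewrite -/(errN X) in F1.
have F2 := le_trans (H2 Y) (ler_wpM2l (ltW K20) (H3 X Y YG)).
have F3 := wsq_ge0 (@one_gt0 n q) (A *m Y).
have F4 : alpha ^+ 2 * wsq (const_mx 1) (A *m Y) <= alpha * (K2 * (K3 * err X Y)).
  by rewrite expr2 -mulrA ler_pM2l //; nra.
have F5 : 0 <= K2 * K3 * errN X by rewrite mulr_ge0 // mulr_ge0 // ltW.
have F6 : 0 <= alpha * (K1 * err X Y).
  by rewrite mulr_ge0 ?(ltW al0) // mulr_ge0 ?(ltW K10) // /err !addr_ge0.
by lra.
Qed.

Theorem tracking_linear_convergence : exists2 alpha : R, 0 < alpha &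
  forall X Y : nat -> 'M[R]_(n, q),
    (forall k, supported (Y k)) -> uno *m Y 0%N = uno *m G (X 0%N) ->
    (forall k, X k.+1 = A *m (X k - alpha *: Y k)) ->
    (forall k, Y k.+1 = C *m Y k + G (X k.+1) - G (X k)) ->
    exists K rho : R, [/\ 0 < K, 0 < rho, rho < 1 &
      forall k, sq (X k - one *m xs) <= K * rho ^+ k].
Proof.
have [c [K1 [a1 [c0 K10 a10 H1]]]] := mean_error_step.
have [t2 [K2 [t20 t21 K20 H2]]] := consensus_step.
have [t3 [K3 [t30 t31 K30 H3]]] := tracking_step.
have [K4 K40 H4] := increment_bound.
(* One constant for all three recursions; [K3 * (L * K4)] is the increment bound passed through [G]
   and the tracking step. *)
pose K := 1 + K1 + K2 + K3 * (L * K4).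
pose tau := Num.max t2 t3.
have K34 : 0 < K3 * (L * K4) by rewrite !mulr_gt0.
have K_ge1 : 1 <= K by rewrite /K; lra.
have tau0 : 0 <= tau by rewrite le_max t20.
have tau1 : tau < 1 by rewrite gt_max t21.
have [a [b [a2 [a0 b0 a20 Hc]]]] := coupled_contraction c0 K_ge1 tau0 tau1.
pose alpha := Num.min 1 (Num.min a1 a2).
have al0 : 0 < alpha by rewrite !lt_min ltr01 a10.
have al1 : alpha <= 1 by rewrite ge_min lexx.
have ala1 : alpha <= a1 by rewrite !ge_min lexx orbT.
have ala2 : alpha <= a2 by rewrite !ge_min lexx !orbT.
have [rho [rho0 rho1 Hrho]] := Hc alpha al0 ala2.
exists alpha => // X Y Ys Y0 XS YS.
have YG k : uno *m Y k = uno *m G (X k).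
  by elim: k => // k IH; exact: (sum_track_step (YS k) IH).
pose V k := errE (X k) + a * errN (X k) + b * errS (Y k).
have V_step k : V k.+1 <= rho * V k.
  have E0 := errE_ge0 (X k); have N0 := errN_ge0 (X k); have S0 := errS_ge0 (Y k).
  have T0 : 0 <= err (X k) (Y k) by rewrite /err !addr_ge0.
  have aK u v : 0 <= v -> u <= K -> alpha * u * v <= alpha * K * v.
    by move=> v0 uK; rewrite -!mulrA ler_pM2l // ler_wpM2r.
  apply: Hrho => //.
  - rewrite /errE (mean_step (XS k)) (le_trans (H1 _ _ _ al0 ala1 (YG k))) //.
    by rewrite lerD2l aK ?addr_ge0 // /K; lra.
  - rewrite /errN (dev_step (XS k)) (le_trans (H2 _ _ _ al0 al1 (YG k))) //.
    apply: lerD; last by rewrite aK // /K; lra.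
    by rewrite ler_wpM2r // le_max lexx.
  - rewrite /errS (track_step (YS k) (YG k)) (le_trans (H3 _ _ (Ys k))) //.
    rewrite -addrA; apply: lerD.
      by rewrite ler_wpM2r // le_max lexx orbT.
    have F1 := H4 _ _ _ al0 al1 (YG k); rewrite -XS in F1.
    have F2 := G_lip (X k.+1) (X k).
    have F3 : K3 * sq (G (X k.+1) - G (X k)) <=
        K3 * (L * (K4 * errN (X k) + alpha * K4 * err (X k) (Y k))).
      by rewrite ler_pM2l // (le_trans F2) // ler_pM2l.
    apply: (le_trans F3).
    have -> : K3 * (L * (K4 * errN (X k) + alpha * K4 * err (X k) (Y k))) =
      K3 * (L * K4) * errN (X k) + alpha * (K3 * (L * K4)) * err (X k) (Y k) by ring.
    apply: lerD; last by rewrite aK // /K; lra.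
    by rewrite ler_wpM2r // /K; lra.
have V_le k : V k <= V 0%N * rho ^+ k.
  elim: k => [|k IH]; first by rewrite expr0 mulr1.
  by rewrite (le_trans (V_step k)) // exprS mulrCA ler_pM2l.
have V_ge0 k : 0 <= V k.
  by rewrite !addr_ge0 // mulr_ge0 ?errN_ge0 ?errS_ge0 // ltW.
have [K5 K50 H5] := wsq_equiv Wr_gt0 (@one_gt0 n q).
have [K6 K60 H6] := wsq_mulmx one We_gt0 (@one_gt0 n q).
pose Kf := 2 * (K5 / a) + 2 * K6.
have Kf0 : 0 < Kf by rewrite addr_gt0 // mulr_gt0 // divr_gt0.
(* The added 1 keeps the constant positive when the initial error is zero. *)
exists (Kf * V 0%N + 1), rho; split=> // [|k].
  by rewrite ltr_wpDl // mulr_ge0 // ltW.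
have -> : X k - one *m xs = dev (X k) + one *m (mean (X k) - xs).
  by rewrite /dev mulmxBr addrA subrK.
rewrite /sq (le_trans (wsqD (@one_gt0 n q) _ _)) //.
have F1 := H5 (dev (X k)); have F2 := H6 (mean (X k) - xs).
rewrite -/(errN _) in F1; rewrite -/(errE _) in F2.
have EV : errE (X k) <= V k.
  by rewrite /V -addrA lerDl addr_ge0 // mulr_ge0 // ltW.
have NV : errN (X k) <= a^-1 * V k.
  rewrite ler_pdivlMl // /V; have := errE_ge0 (X k).
  have : 0 <= b * errS (Y k) by rewrite mulr_ge0 // ltW.
  by lra.
have F3 : K5 * errN (X k) <= K5 / a * V k by rewrite -mulrA ler_pM2l.
have F4 : K6 * errE (X k) <= K6 * V k by rewrite ler_pM2l.
have F5 : Kf * V k <= Kf * (V 0%N * rho ^+ k) by rewrite ler_pM2l.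
have F6 : 0 <= rho ^+ k by rewrite exprn_ge0 // ltW.
by rewrite /Kf in F5 *; lra.
Qed.

End Tracking.

(** * Equilibria *)

(** Completeness of the matrix space, for Banach's fixed point theorem. *)
HB.instance Definition _ (R : realType) (m n : nat) :=
  Uniform_isComplete.Build 'M[R]_(m, n) (@mx_complete R m n).

Section FixedPoint.
Variables (R : realType) (q : nat).
Implicit Types x y : 'rV[R]_q.

Lemma wsq_le_norm x : wsq (const_mx 1) x <= q%:R * `|x| ^+ 2.
Proof.
rewrite /wsq big_ord1 mulr_natl -[X in _ *+ X](card_ord q) -sumr_const.
apply: ler_sum => j _; rewrite mxE mul1r -real_normK ?num_real //.
rewrite lerXn2r ?nnegrE // [leRHS]/Num.Def.normr/= mx_normrE.
by apply/bigmax_geP; right; exists (0, j).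
Qed.

Lemma norm_le_wsq x (B : R) : 0 <= B -> wsq (const_mx 1) x <= B ^+ 2 -> `|x| <= B.
Proof.
move=> B0 xB; rewrite [leLHS]/Num.Def.normr/= mx_normrE bigmax_le //= => -[i j] _ /=.
rewrite -(ger0_norm B0) -ler_sqr ?nnegrE // !real_normK ?num_real //.
apply: le_trans xB; have W0 : posmx (const_mx 1 : 'rV[R]_q) by move=> k l; rewrite mxE.
by apply: le_trans (wsq_entry W0 x i j); rewrite mxE mul1r.
Qed.

(** [T] contracts in the Euclidean norm, while the norm on row vectors is the sup norm. A high
    iterate of [T] beats the comparison factor [q], and its fixed point is fixed by [T] as well. *)
Lemma strongly_monotone_zero (M : 'rV[R]_q -> 'rV[R]_q) (K mu : R) :
  0 <= K -> 0 < mu ->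
  (forall x y, wsq (const_mx 1) (M x - M y) <= K * wsq (const_mx 1) (x - y)) ->
  (forall x y, mu * wsq (const_mx 1) (x - y) <=
     \sum_j (M x - M y) 0 j * (x - y) 0 j) ->
  exists x, M x = 0.
Proof.
move=> K0 mu0 Mlip Mmono.
(* With [t = mu / K'] the factor [1 - 2 * t * mu + t ^+ 2 * K] is at most [K / K'], which the added
   [mu ^+ 2] pushes below 1. *)
pose K' := K + mu ^+ 2; have K'0 : 0 < K' by rewrite ltr_wpDl // exprn_gt0.
pose t := mu / K'; have t0 : 0 < t by rewrite divr_gt0.
pose T x := x - t *: M x; pose s := K / K'.
have s0 : 0 <= s by rewrite divr_ge0 // ltW.
have s1 : s < 1 by rewrite ltr_pdivrMr // mul1r ltrDl exprn_gt0.
have T_contr x y : wsq (const_mx 1) (T x - T y) <= s * wsq (const_mx 1) (x - y).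
  have -> : wsq (const_mx 1) (T x - T y) = wsq (const_mx 1) (x - y)
      - 2 * t * \sum_j (M x - M y) 0 j * (x - y) 0 j
      + t ^+ 2 * wsq (const_mx 1) (M x - M y).
    rewrite /wsq !big_ord1 !mulr_sumr -sumrB -big_split.
    by apply: eq_bigr => j _ /=; rewrite !mxE; ring.
  have H1 := Mlip x y; have H2 := Mmono x y.
  have F1 : t * (mu * wsq (const_mx 1) (x - y)) <=
    t * \sum_j (M x - M y) 0 j * (x - y) 0 j by rewrite ler_pM2l.
  have F2 : t ^+ 2 * wsq (const_mx 1) (M x - M y) <=
    t ^+ 2 * (K * wsq (const_mx 1) (x - y)) by rewrite ler_pM2l // exprn_gt0.
  have F3 : 0 <= wsq (const_mx 1) (x - y) by apply: wsq_ge0 => i j; rewrite mxE.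
  have -> : s * wsq (const_mx 1) (x - y) = wsq (const_mx 1) (x - y)
     - 2 * (t * (mu * wsq (const_mx 1) (x - y)))
     + t ^+ 2 * (K * wsq (const_mx 1) (x - y))
     + t ^+ 2 * (mu ^+ 2 * wsq (const_mx 1) (x - y)).
    by rewrite /s /t /K'; field; rewrite gt_eqF.
  have F4 : 0 <= t ^+ 2 * (mu ^+ 2 * wsq (const_mx 1) (x - y)).
    by rewrite mulr_ge0 ?sqr_ge0 // mulr_ge0 ?sqr_ge0.
  by lra.
have TN_contr N x y : wsq (const_mx 1) (iter N T x - iter N T y) <=
    s ^+ N * wsq (const_mx 1) (x - y).
  elim: N => [|N IH]; first by rewrite expr0 mul1r.
  by rewrite !iterS exprS -mulrA (le_trans (T_contr _ _)) // ler_wpM2l.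
(* A factor 1/4 on squared norms gives the Lipschitz constant 1/2 in the sup norm. *)
have [N HN] : exists N : nat, s ^+ N * q%:R <= 4^-1.
  have Hs : (fun N => s ^+ N * q%:R) @ \oo --> (0 * q%:R : R).
    by apply: cvgMl; apply: cvg_expr; rewrite ger0_norm.
  rewrite mul0r in Hs; have q4 : (0 : R) < 4^-1 by rewrite invr_gt0.
  have [N _ HN] := (@cvgr0Pnorm_le _ _ _ _ _ _).1 Hs _ q4.
  by exists N; have := HN N (leqnn N); rewrite /= ger0_norm // mulr_ge0 // exprn_ge0.
pose F := 'totalfun_setT (iter N T).
have F_half x y : `|F x - F y| <= 2^-1 * `|x - y|.
  apply: norm_le_wsq; first by rewrite mulr_ge0 // invr_ge0.
  rewrite (le_trans (TN_contr N x y)) //.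
  rewrite (le_trans (ler_wpM2l (exprn_ge0 N s0) (wsq_le_norm _))) //.
  rewrite mulrA [leRHS]exprMn ler_wpM2r ?sqr_ge0 // (le_trans HN) //.
  by rewrite exprVn -natrX.
have [p _ Fp] : exists2 p, setT p & p = F p.
  apply: banach_fixed_point; last 2 first.
  - exact: closedT.
  - by exists 0.
  have h0 : (0 : R) <= 2^-1 by rewrite invr_ge0.
  exists (NngNum h0); split => /=; first by rewrite invf_lt1 // ltr1n.
  by move=> [x y] _; exact: F_half.
exists p.
(* [T p] is another fixed point of the iterate, so contraction by 1/2 identifies it with [p]. *)
have TpT : iter N T (T p) = T p.
  by rewrite -iterSr iterS; congr T; exact/esym.
have Tp : `|T p - p| <= 2^-1 * `|T p - p|.
  by rewrite -{1}[T p]TpT {2}Fp; exact: F_half.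
have Tp0 : T p - p = 0.
  apply/eqP; rewrite -normr_le0; have := normr_ge0 (T p - p); lra.
move: Tp0; rewrite /T addrAC subrr add0r => /eqP.
by rewrite oppr_eq0 scaler_eq0 gt_eqF //= => /eqP.
Qed.
End FixedPoint.

Lemma sum_Rank (R : nmodType) (p : nat) (p_ : 'I_p -> nat)
    (F : 'I_(\sum_(h < p) p_ h) -> R) :
  \sum_a F a = \sum_h \sum_(i < p_ h) F (tagnat.Rank h i).
Proof.
rewrite sig_big_dep /= (reindex _ tagnat.sig_bij_on) /=.
by apply: eq_bigr => a _; rewrite -{1}[a]tagnat.sig2K.
Qed.

(** The derivative is the limit of right quotients, so positive [t] suffice; the bound [t <= 1]
    suits convex combinations. *)
Lemma derive_le_quotient (R : realType) (V : normedModType R) (F : V -> R)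
    (x v : V) (B : R) : derivable F x v ->
  (forall t : R, 0 < t -> t <= 1 -> F (t *: v + x) - F x <= t * B) -> 'D_v F x <= B.
Proof.
move=> dF FB; rewrite /derive cvg_at_rightE //; apply: limr_le.
  rewrite -(cvg_at_rightE (fun h : R => h^-1 *: ((F \o shift x) _ - F x))) //.
  apply: cvg_trans dF; apply: cvg_app.
  move=> A [e egt0 Ae]; exists e => // y xe xgt0; apply: Ae => //.
  exact/lt0r_neq0.
near=> h; have h0 : 0 < h by near: h; exists 1 => /=.
have h1 : h <= 1.
  near: h; exists 1; [exact: ltr01 | move=> h; rewrite /= distrC subr0 => h1 _].
  by rewrite (le_trans (ler_norm _)) // ltW.
by rewrite /= [_ *: _]mulrC ler_pdivrMr // mulrC; exact: FB.
Unshelve. all: by end_near. Qed.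

Lemma derive_ge_quotient (R : realType) (V : normedModType R) (F : V -> R)
    (x v : V) (B : R) : derivable F x v ->
  (forall t : R, 0 < t -> t <= 1 -> t * B <= F (t *: v + x) - F x) -> B <= 'D_v F x.
Proof.
move=> dF FB; rewrite -lerN2 -deriveN //; apply: derive_le_quotient.
  exact: derivableN.
by move=> t t0 t1; rewrite mulrN -opprD lerN2; exact: FB.
Qed.

Lemma derive_grad (R : realType) (q : nat) (f : 'rV[R]_q -> R) (x v : 'rV[R]_q) :
  differentiable f x -> 'D_v f x = \sum_c grad f x 0 c * v 0 c.
Proof.
move=> df; rewrite deriveE // {1}[v]row_sum_delta linear_sum.
by apply: eq_bigr => c _; rewrite linearZ mxE deriveE //= mulrC.
Qed.

(** * First-order characterization of Nash equilibria *)

Section Nash.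
Variables (R : realType) (H : nat) (nh qh : 'I_H -> nat).
Local Notation q := (\sum_(h < H) qh h)%N.
Variable f : forall h : 'I_H, 'I_(nh h) -> 'rV[R]_q -> R.
Arguments f : clear implicits.
Hypothesis f_convex : forall h i, convex_fun (f h i).
Hypothesis f_diff : forall h i x, differentiable (f h i) x.

Lemma blkE (x : 'rV[R]_q) h c : blk x h 0 c = x 0 (tagnat.Rank h c).
Proof. by rewrite mxE. Qed.

Lemma blk_setblk (x : 'rV[R]_q) h (z : 'rV[R]_(qh h)) : blk (setblk x z) h = z.
Proof.
by rewrite /blk /setblk mxrowK; case: eqP => // e; rewrite (eq_axiomK e).
Qed.

Lemma blk_setblk_neq (x : 'rV[R]_q) h (z : 'rV[R]_(qh h)) j :
  j != h -> blk (setblk x z) j = blk x j.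
Proof.
rewrite eq_sym => jh; rewrite /blk /setblk mxrowK.
by case: eqP => // e; rewrite e eqxx in jh.
Qed.

(** Turns a unilateral deviation into a translation along a direction supported in block [h], so
    that directional derivatives apply. *)
Lemma setblkE (x : 'rV[R]_q) h (z : 'rV[R]_(qh h)) :
  setblk x z = setblk 0 (z - blk x h) + x.
Proof.
apply/mxrowP => j; rewrite submxrowD -!/(blk _ j).
have [->|jh] := eqVneq j h; first by rewrite !blk_setblk subrK.
by rewrite !blk_setblk_neq // /blk submxrow0 add0r.
Qed.

Lemma setblkZ h (z : 'rV[R]_(qh h)) (t : R) :
  setblk (0 : 'rV[R]_q) (t *: z) = t *: setblk 0 z.
Proof.
apply/mxrowP => j.
have -> : submxrow (t *: setblk (0 : 'rV[R]_q) z) j = t *: blk (setblk 0 z) j.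
  by apply/matrixP => a b; rewrite !mxE.
rewrite -!/(blk _ j).
have [->|jh] := eqVneq j h; first by rewrite !blk_setblk.
by rewrite !blk_setblk_neq // /blk submxrow0 scaler0.
Qed.

Lemma Fcl_derive h (x : 'rV[R]_q) (u : 'rV[R]_(qh h)) :
  is_derive x (setblk 0 u) (Fcl f h) (\sum_c gcl f h x 0 c * u 0 c).
Proof.
have -> : Fcl f h = \sum_(i < nh h) f h i.
  by apply/funext => y; rewrite fct_sumE.
have -> : \sum_c gcl f h x 0 c * u 0 c =
    \sum_(i < nh h) 'D_(setblk 0 u) (f h i) x.
  under [RHS]eq_bigr do rewrite derive_grad // sum_Rank (bigD1 h) //=.
  under [RHS]eq_bigr => i _.
    rewrite [X in _ + X]big1 ?addr0; first over.
    move=> j jh; apply: big1 => c _.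
    by rewrite -(blkE (setblk _ _)) blk_setblk_neq // blkE [X in _ * X]mxE mulr0.
  rewrite exchange_big; apply: eq_bigr => c _ /=.
  rewrite summxE mulr_suml; apply: eq_bigr => i _.
  by rewrite -(blkE (setblk _ _)) blk_setblk blkE.
by apply: is_derive_sum => i; apply/derivableP/diff_derivable.
Qed.

(** By convexity the difference quotients toward a deviation are at most the cost increase; hence so
    is their limit, which is zero here. *)
Lemma gcl0_nash (x : 'rV[R]_q) : (forall h, gcl f h x = 0) -> nash_eq f x.
Proof.
move=> g0 h z; rewrite setblkE; set v := setblk 0 _.
have [dF DF] := Fcl_derive x (z - blk x h); rewrite -/v g0 in dF DF.
have {}DF : 'D_v (Fcl f h) x = 0.
  by rewrite DF big1 // => c _; rewrite mxE mul0r.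
rewrite -subr_ge0 -DF; apply: derive_le_quotient => // t t0 t1.
suff : Fcl f h (t *: v + x) <= t * Fcl f h (v + x) + (1 - t) * Fcl f h x by lra.
rewrite /Fcl !mulr_sumr -big_split; apply: ler_sum => i _ /=.
have := @f_convex h i (v + x) x t; rewrite t1 ltW //= => /(_ isT).
by rewrite scalerDr -addrA -scalerDl [t + _]addrC subrK scale1r.
Qed.

(** At a minimum every derivative in a block direction is nonnegative; the direction [- gcl f h x]
    then forces the gradient to vanish. *)
Lemma nash_gcl0 (x : 'rV[R]_q) : nash_eq f x -> forall h, gcl f h x = 0.
Proof.
move=> Nx h.
have ge0 (u : 'rV[R]_(qh h)) : 0 <= \sum_c gcl f h x 0 c * u 0 c.
  have [dF <-] := Fcl_derive x u; apply: derive_ge_quotient => // t t0 _.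
  rewrite mulr0 subr_ge0 -setblkZ.
  by have := Nx h (t *: u + blk x h); rewrite setblkE addrK.
have := ge0 (- gcl f h x).
under eq_bigr do rewrite mxE mulrN -expr2; rewrite sumrN oppr_ge0 => le0.
apply/rowP => c; rewrite mxE; apply/eqP; rewrite -sqrf_eq0; apply/eqP.
have sq0 : \sum_c gcl f h x 0 c ^+ 2 = 0.
  by apply/eqP; rewrite eq_le le0; apply: sumr_ge0 => ? _; exact: sqr_ge0.
by move/psumr_eq0P: sq0; apply=> // ? _; exact: sqr_ge0.
Qed.

End Nash.

(** * Block structure *)

Lemma norm2_ge0 (R : realType) (m : nat) (v : 'rV[R]_m) : 0 <= norm2 v.
Proof. exact: sqrtr_ge0. Qed.

Lemma sqr_norm2 (R : realType) (m : nat) (v : 'rV[R]_m) :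
  norm2 v ^+ 2 = wsq (const_mx 1) v.
Proof.
rewrite /norm2 sqr_sqrtr /dotr; last by apply: sumr_ge0 => c _; rewrite -expr2 sqr_ge0.
by rewrite /wsq big_ord1; apply: eq_bigr => c _; rewrite mxE mul1r expr2.
Qed.

Lemma norm2_le (R : realType) (m : nat) (v : 'rV[R]_m) (B : R) :
  0 <= B -> wsq (const_mx 1) v <= B ^+ 2 -> norm2 v <= B.
Proof. by move=> B0; rewrite -sqr_norm2 ler_sqr ?nnegrE ?norm2_ge0. Qed.

Section Blocks.
Variables (R : realType) (H : nat) (nh qh : 'I_H -> nat).
Local Notation q := (\sum_(h < H) qh h)%N.
Local Notation n := (\sum_(h < H) nh h)%N.

Lemma Rank_ind (p_ : 'I_H -> nat) (P : 'I_(\sum_(h < H) p_ h) -> Prop) :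
  (forall h i, P (tagnat.Rank h i)) -> forall a, P a.
Proof. by move=> PR a; rewrite -[a]tagnat.sig2K. Qed.

Lemma mxblockE_Rank (p_ r_ : 'I_H -> nat) (B : forall h k, 'M[R]_(p_ h, r_ k)) h k i j :
  (\mxblock_(h, k) B h k) (tagnat.Rank h i) (tagnat.Rank k j) = B h k i j.
Proof. by rewrite -[in RHS](mxblockK B h k) [RHS]mxE. Qed.

Lemma blkdiagE (y : forall h, 'M[R]_(nh h, qh h)) h i c :
  blkdiag y (tagnat.Rank h i) (tagnat.Rank h c) = y h i c.
Proof. by rewrite mxblockE_Rank; case: eqP => // e; rewrite (eq_axiomK e). Qed.

Lemma blkdiagE_neq (y : forall h, 'M[R]_(nh h, qh h)) h k i c : h != k ->
  blkdiag y (tagnat.Rank h i) (tagnat.Rank k c) = 0.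
Proof.
move=> hk; rewrite mxblockE_Rank; case: eqP => [e|_]; last by rewrite mxE.
by rewrite e eqxx in hk.
Qed.

Lemma eq_blkdiag (A : 'M[R]_(n, q)) (y : forall h, 'M[R]_(nh h, qh h)) :
  (forall h i c, A (tagnat.Rank h i) (tagnat.Rank h c) = y h i c) ->
  (forall h k i c, h != k -> A (tagnat.Rank h i) (tagnat.Rank k c) = 0) ->
  A = blkdiag y.
Proof.
move=> Ay A0; apply/matrixP; elim/Rank_ind => h i; elim/Rank_ind => k c.
have [hk|hk] := eqVneq h k; last by rewrite A0 ?blkdiagE_neq.
by case: _ / hk c => c; rewrite Ay blkdiagE.
Qed.

Lemma blkdiagD (y z : forall h, 'M[R]_(nh h, qh h)) :
  blkdiag (fun h => y h + z h) = blkdiag y + blkdiag z.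
Proof.
apply/esym/eq_blkdiag => [h i c|h k i c hk]; rewrite mxE.
  by rewrite !blkdiagE mxE.
by rewrite !blkdiagE_neq // addr0.
Qed.

Lemma blkdiagN (y : forall h, 'M[R]_(nh h, qh h)) :
  blkdiag (fun h => - y h) = - blkdiag y.
Proof.
apply/esym/eq_blkdiag => [h i c|h k i c hk]; rewrite mxE.
  by rewrite !blkdiagE mxE.
by rewrite !blkdiagE_neq // oppr0.
Qed.

Lemma mul_mxdiag_blkdiag (C : forall h, 'M[R]_(nh h)) (y : forall h, 'M[R]_(nh h, qh h)) :
  (\mxdiag_h C h) *m blkdiag y = blkdiag (fun h => C h *m y h).
Proof.
rewrite /blkdiag mul_mxdiag_mxblock; apply: eq_mxblock => h k.
by case: eqP => [e|_]; [case: _ / e | rewrite mulmx0].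
Qed.

Lemma mulmx_blkdiagE (u : 'rV[R]_n) (y : forall h, 'M[R]_(nh h, qh h)) h c :
  (u *m blkdiag y) 0 (tagnat.Rank h c) = \sum_i u 0 (tagnat.Rank h i) * y h i c.
Proof.
rewrite mxE sum_Rank (bigD1 h) //= [X in _ + X]big1 ?addr0; last first.
  by move=> k kh; apply: big1 => i _; rewrite blkdiagE_neq // mulr0.
by apply: eq_bigr => i _; rewrite blkdiagE.
Qed.

Lemma wsq_blkdiag (W : 'M[R]_(n, q)) (y : forall h, 'M[R]_(nh h, qh h)) :
  wsq W (blkdiag y) = \sum_h \sum_i \sum_c
    W (tagnat.Rank h i) (tagnat.Rank h c) * y h i c ^+ 2.
Proof.
rewrite /wsq sum_Rank; apply: eq_bigr => h _; apply: eq_bigr => i _.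
rewrite sum_Rank (bigD1 h) //= [X in _ + X]big1 ?addr0; last first.
  move=> k kh; apply: big1 => c _.
  by rewrite blkdiagE_neq 1?eq_sym // expr0n mulr0.
by apply: eq_bigr => c _; rewrite blkdiagE.
Qed.

End Blocks.

(** * The stacked gradient and the game map *)

Section Flat.
Variables (R : realType) (H : nat) (nh qh : 'I_H -> nat).
Local Notation q := (\sum_(h < H) qh h)%N.
Local Notation n := (\sum_(h < H) nh h)%N.
Variable f : forall h : 'I_H, 'I_(nh h) -> 'rV[R]_q -> R.
Arguments f : clear implicits.

(** Serves as [G] in the tracking analysis: with the blocks on the diagonal, the column sums at a
    consensus point form the whole game map. *)
Definition stacked_gradient (X : 'M[R]_(n, q)) : 'M[R]_(n, q) :=
  blkdiag (fun h => Gmat f h X).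

Lemma GmatE h (X : 'M[R]_(n, q)) i c :
  Gmat f h X i c = blk (grad (f h i) (row (tagnat.Rank h i) X)) h 0 c.
Proof.
by rewrite mxE; congr (blk (grad _ _) _ _ _); apply/rowP => a; rewrite !mxE.
Qed.

Lemma game_map_stacked (x : 'rV[R]_q) :
  const_mx 1 *m stacked_gradient (const_mx 1 *m x) = game_map f x.
Proof.
apply/rowP; elim/Rank_ind => h c; rewrite mulmx_blkdiagE.
rewrite -[RHS]blkE /blk mxrowK summxE; apply: eq_bigr => i _.
rewrite mxE mul1r GmatE; congr (blk (grad _ _) _ _ _).
by apply/rowP => a; rewrite !mxE big_ord1 mxE mul1r.
Qed.

(** Each row depends only on the same row of [X], so the squared agentwise bounds add up without a
    dimension factor. *)
Lemma stacked_gradient_lip (L : R) : 0 <= L ->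
  (forall h i (x x' : 'rV[R]_q),
    norm2 (blk (grad (f h i) x) h - blk (grad (f h i) x') h) <= L * norm2 (x - x')) ->
  forall X X', wsq (const_mx 1) (stacked_gradient X - stacked_gradient X') <=
    L ^+ 2 * wsq (const_mx 1) (X - X').
Proof.
move=> L0 f_lip X X'; rewrite /stacked_gradient -blkdiagN -blkdiagD wsq_blkdiag.
rewrite [leRHS]mulr_sumr sum_Rank; apply: ler_sum => h _; apply: ler_sum => i _.
set a := tagnat.Rank h i.
have LX0 : 0 <= L * norm2 (row a X - row a X') by rewrite mulr_ge0 ?norm2_ge0.
have le := f_lip h i (row a X) (row a X').
rewrite -ler_sqr ?nnegrE ?norm2_ge0 // exprMn !sqr_norm2 /wsq !big_ord1 in le.
apply: le_trans (le_trans le _).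
  apply: ler_sum => c _.
  have -> : (Gmat f h X - Gmat f h X') i c =
      (blk (grad (f h i) (row a X)) h - blk (grad (f h i) (row a X')) h) 0 c.
    by rewrite mxE [X in _ + X]mxE !GmatE [RHS]mxE [X in _ = _ + X]mxE.
  by rewrite ![const_mx _ _ _]mxE.
by rewrite ler_wpM2l ?sqr_ge0 //; apply: ler_sum => c _; rewrite !mxE.
Qed.

(** An empty cluster would make the game map zero on its block, against strong monotonicity along a
    coordinate of that block. This gives every column of [P] a normalized Perron vector. *)
Lemma cluster_inhabited (mu : R) : 0 < mu ->
  (forall x y : 'rV[R]_q,
    mu * norm2 (x - y) ^+ 2 <= dotr (game_map f x - game_map f y) (x - y)) ->
  forall h, 'I_(qh h) -> (0 < nh h)%N.
Proof.
move=> mu0 mono h c; rewrite lt0n; apply/eqP => nh0.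
have gcl0 x : gcl f h x = 0.
  by apply: big1 => i; exfalso; have := ltn_ord i; rewrite [X in (_ < X)%N]nh0.
have := mono (delta_mx 0 (tagnat.Rank h c)) 0; rewrite subr0 sqr_norm2.
have -> : wsq (const_mx 1) (delta_mx 0 (tagnat.Rank h c) : 'rV[R]_q) = 1.
  rewrite /wsq big_ord1 (bigD1 (tagnat.Rank h c)) //= [X in _ + X]big1 => [|a /negbTE ac].
    by rewrite !mxE !eqxx addr0 expr1n mulr1.
  by rewrite !mxE ac andbF expr0n mulr0.
rewrite /dotr (bigD1 (tagnat.Rank h c)) //= [X in _ + X]big1 => [|a /negbTE ac].
  have -> : (game_map f (delta_mx 0 (tagnat.Rank h c)) - game_map f 0) 0
      (tagnat.Rank h c) = 0.
    by rewrite -blkE /blk submxrowB !mxrowK !gcl0 subrr mxE.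
  rewrite mul0r addr0 mulr1.
  by rewrite leNgt mu0.
by rewrite [X in _ * X]mxE ac andbF mulr0.
Qed.

End Flat.

(** * Existence, uniqueness and linear convergence for the clustered game *)

Theorem theorem1 (R : realType) (H : nat) (nh qh : 'I_H -> nat)
  (C : forall h : 'I_H, 'M[R]_(nh h))
  (Rm : 'M[R]_(\sum_(h < H) nh h))
  (f : forall h : 'I_H, 'I_(nh h) -> 'rV[R]_(\sum_(h < H) qh h) -> R)
  (L mu : R) :
  (* (A1) *)
  (forall h, nonneg_mx (C h) /\ col_stochastic (C h) /\ pos_diag (C h)
             /\ strongly_connected (C h)) ->
  (* (A2) *)
  nonneg_mx Rm -> row_stochastic Rm -> pos_diag Rm -> strongly_connected Rm ->
  (* (A3) *)
  (forall h i, convex_fun (f h i) /\ C1_fun (f h i)) ->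
  0 < L ->
  (forall h i (x x' : 'rV[R]_(\sum_(h < H) qh h)),
      norm2 (blk (grad (f h i) x) h - blk (grad (f h i) x') h)
        <= L * norm2 (x - x')) ->
  (* (A4) *)
  0 < mu ->
  (forall x y : 'rV[R]_(\sum_(h < H) qh h),
      dotr (game_map f x - game_map f y) (x - y) >= mu * norm2 (x - y) ^+ 2) ->
  exists xs : 'rV[R]_(\sum_(h < H) qh h),
    [/\ nash_eq f xs,
        (forall z, nash_eq f z -> z = xs),
        (forall h, gcl f h xs = 0) &
        exists2 alpha : R, 0 < alpha &
          forall (X : nat -> 'M[R]_(\sum_(h < H) nh h, \sum_(h < H) qh h))
                 (Y : nat -> forall h : 'I_H, 'M[R]_(nh h, qh h)),
            (forall h, Y 0%N h = Gmat f h (X 0%N)) ->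
            (forall k, X k.+1 = Rm *m (X k - alpha *: blkdiag (Y k))) ->
            (forall k h, Y k.+1 h = C h *m Y k h + Gmat f h (X k.+1) - Gmat f h (X k)) ->
            (forall i, (fun k => row i (X k)) @ \oo --> xs) /\
            exists Cst rho : R, [/\ 0 < Cst, 0 < rho, rho < 1 &
              forall i k, norm2 (row i (X k) - xs) <= Cst * rho ^+ k]].
Proof.
move=> CA Rm_ge0 Rm_sum Rm_diag Rm_conn f_reg L0 f_lip mu0 f_mono.
pose n := (\sum_(h < H) nh h)%N; pose q := (\sum_(h < H) qh h)%N.
have f_convex h i : convex_fun (f h i) := (f_reg h i).1.
have f_diff h i x : differentiable (f h i) x by exact: (f_reg h i).2.1.
have G_lip := stacked_gradient_lip (ltW L0) f_lip.
have game_mono x y : mu * wsq (const_mx 1) (x - y) <=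
    \sum_j (game_map f x - game_map f y) 0 j * (x - y) 0 j.
  by rewrite -sqr_norm2; exact: f_mono.
have L2 : 0 < L ^+ 2 by rewrite exprn_gt0.
have pos1 m p : posmx (const_mx 1 : 'M[R]_(m, p)) by move=> i j; rewrite mxE.
have [Kg Kg0 g_lip] := game_lip L2 G_lip.
have [xs xs0] : exists xs, game_map f xs = 0.
  apply: (strongly_monotone_zero (ltW Kg0) mu0) game_mono => x y.
  by rewrite -!game_map_stacked; exact: g_lip.
have gcl_zero z h : game_map f z = 0 -> gcl f h z = 0.
  by move=> z0; rewrite -[LHS](mxrowK (fun h => gcl f h z)) -/(game_map f z) z0 submxrow0.
exists xs; split.
- by apply: gcl0_nash => // h; exact: gcl_zero.
- move=> z /(nash_gcl0 f_diff) gz.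
  have z0 : game_map f z = 0.
    by apply/mxrowP => h; rewrite mxrowK gz submxrow0.
  have := game_mono z xs; rewrite z0 xs0 subrr [X in _ <= X -> _]big1 => [|j _]; last by rewrite mxE mul0r.
  rewrite pmulr_rle0 // => zxs; apply/eqP; rewrite -subr_eq0 -normr_le0.
  by apply: norm_le_wsq => //; rewrite expr0n.
- by move=> h; exact: gcl_zero.
(* Without agents there are no rows to converge, so any step-size works. *)
have [n0|n_gt0] := posnP n.
  have no_index (i : 'I_n) : False by have := ltn_ord i; rewrite [X in (_ < X)%N]n0.
  exists 1 => // X Y _ _ _; split; first by move=> i; case: (no_index i).
  by exists 1, 2^-1; split=> //; rewrite invf_lt1 // ltr1n.
have [r [r0 rR /(_ n_gt0) r1]] := stationary_distribution Rm_ge0 Rm_sum Rm_conn.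
have [sgA [sgA0 sgA1 A_contr]] := averaging_contraction Rm_ge0 Rm_sum Rm_conn r0 rR Rm_diag r1.
have [p [sg Hp]] : exists (p : forall h, 'I_(nh h) -> R) (sg : 'I_H -> R), forall h,
    [/\ forall i, 0 < p h i, forall i, \sum_j C h i j * p h j = p h i,
      ((0 < nh h)%N -> \sum_i p h i = 1), 0 <= sg h < 1 &
      forall y : 'I_(nh h) -> R, \sum_i y i = 0 ->
      \sum_i (p h i)^-1 * (\sum_j C h i j * y j) ^+ 2 <=
        sg h * \sum_i (p h i)^-1 * y i ^+ 2].
  have Hh h := let: conj a (conj b (conj c d)) := CA h in
    column_stochastic_contraction a b c d.
  by have [p /fin_all_exists[sg Hp]] := fin_all_exists Hh; exists p, sg.
(* One factor for all clusters; the default 0 keeps it in [[0, 1)] even when there is no cluster. *)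
pose sgC := \big[Num.max/0]_h sg h.
have sgC0 : 0 <= sgC by exact: bigmax_ge_id.
have sgC1 : sgC < 1 by apply/bigmax_ltP; split=> // h _; have [_ _ _ /andP[]] := Hp h.
pose rv : 'rV[R]_n := \row_i r i.
pose P : 'M[R]_(n, q) := blkdiag (fun h => \matrix_(i, c) p h i).
(* Positive at every entry, as a weight must be, though tracking errors live on the diagonal blocks
   only. *)
pose W : 'M[R]_(n, q) := \matrix_(i, j) (p _ (tagnat.sig2 i))^-1.
have WE h i c : W (tagnat.Rank h i) c = (p h i)^-1.
  rewrite mxE tagnat.Rank2K; congr (_^-1).
  by move: (esym _) => e; case: _ / e; rewrite cast_ord_id.
have p0 h i : 0 < p h i by have [] := Hp h.
have nh0 := cluster_inhabited mu0 f_mono.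
pose supp (i : 'I_n) (j : 'I_q) := tagnat.sig1 i == tagnat.sig1 j.
have blk_supp (y : forall h, 'M[R]_(nh h, qh h)) i j : ~~ supp i j -> blkdiag y i j = 0.
  elim/Rank_ind: i => h i; elim/Rank_ind: j => k c.
  by rewrite /supp !tagnat.Rank1K; exact: blkdiagE_neq.
have blk_nsupp (V : 'M[R]_(n, q)) : (forall i j, ~~ supp i j -> V i j = 0) ->
    V = blkdiag (fun h => submxblock V h h).
  move=> V0; apply: eq_blkdiag => [h i c|h k i c hk]; first by rewrite mxE.
  by rewrite V0 // /supp !tagnat.Rank1K.
have rv0 : posmx rv by move=> i j; rewrite mxE.
have rvR : rv *m Rm = rv.
  by apply/rowP => j; rewrite !mxE -[RHS]rR; apply: eq_bigr => i _; rewrite mxE.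
have R_one : Rm *m const_mx 1 = const_mx 1 :> 'cV[R]_n.
  apply/colP => i; rewrite !mxE -[RHS](Rm_sum i); apply: eq_bigr => j _.
  by rewrite mxE mulr1.
have rv_one : rv *m const_mx 1 = 1%:M.
  apply/rowP => j; rewrite ord1 !mxE eqxx -[RHS]r1; apply: eq_bigr => i _.
  by rewrite !mxE mulr1.
have R_contr (V : 'M[R]_(n, q)) : rv *m V = 0 ->
    wsq (\matrix_(i < n, j < q) rv 0 i) (Rm *m V) <=
    sgA * wsq (\matrix_(i < n, j < q) rv 0 i) V.
  (* [Rm] acts on each column separately, so the scalar contraction is summed over columns. *)
  move=> V0; rewrite /wsq exchange_big [in leRHS]exchange_big mulr_sumr.
  apply: ler_sum => j _; have := A_contr (fun i => V i j).
  have -> : \sum_i r i * V i j = 0.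
    have /rowP/(_ j) := V0; rewrite mxE [RHS]mxE => rV; rewrite -[RHS]rV.
    by apply: eq_bigr => i _; rewrite mxE.
  move=> /(_ erefl) le; under eq_bigr do rewrite !mxE.
  by under [X in _ <= _ * X]eq_bigr do rewrite !mxE.
have uno_C : const_mx 1 *m (\mxdiag_h C h) = const_mx 1 :> 'rV[R]_n.
  apply/rowP; elim/Rank_ind => h j; rewrite !mxE sum_Rank (bigD1 h) //=.
  rewrite [X in _ + X]big1 ?addr0 => [|k kh].
    have [_ [Csum _]] := CA h; rewrite -[RHS](Csum j); apply: eq_bigr => i _.
    by rewrite mxE mul1r -[in RHS](submxblock_diag C h) [RHS]mxE.
  apply: big1 => i _; rewrite /mxdiag mxblockE_Rank (negbTE kh) mxE.
  by rewrite [X in _ * X]mxE mulr0.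
have C_P : (\mxdiag_h C h) *m P = P.
  rewrite mul_mxdiag_blkdiag; apply: eq_blkdiag => [h i c|h k i c]; last exact: blkdiagE_neq.
  have [_ pC _ _ _] := Hp h; rewrite blkdiagE !mxE -[RHS]pC.
  by apply: eq_bigr => j _; rewrite mxE.
have uno_P : const_mx 1 *m P = const_mx 1 :> 'rV[R]_q.
  apply/rowP; elim/Rank_ind => h c; rewrite mulmx_blkdiagE mxE.
  have [_ _ /(_ (nh0 h c)) p1 _ _] := Hp h; rewrite -[RHS]p1.
  by apply: eq_bigr => i _; rewrite !mxE mul1r.
have w0 : posmx (rv *m P).
  move=> a; rewrite ord1 => {a}; elim/Rank_ind => h c.
  rewrite mulmx_blkdiagE (bigD1 (Ordinal (nh0 h c))) //= ltr_pwDl //.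
    by rewrite !mxE mulr_gt0.
  by apply: sumr_ge0 => i _; rewrite !mxE mulr_ge0 // ltW.
have W0 : posmx W.
  by elim/Rank_ind => h i j; rewrite WE invr_gt0.
have C_contr (V : 'M[R]_(n, q)) : (forall i j, ~~ supp i j -> V i j = 0) ->
    const_mx 1 *m V = 0 :> 'rV[R]_q ->
    wsq W ((\mxdiag_h C h) *m V) <= sgC * wsq W V.
  (* [V] consists of its diagonal blocks, so each zero column sum is a zero sum within a single
     cluster. *)
  move=> /blk_nsupp ->; set v := fun h => _; move=> V0.
  rewrite mul_mxdiag_blkdiag !wsq_blkdiag mulr_sumr; apply: ler_sum => h _.
  rewrite exchange_big [in leRHS]exchange_big mulr_sumr; apply: ler_sum => c _ /=.
  have [_ _ _ /andP[sg0 _]] := Hp h; move=> /(_ (fun i => v h i c)).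
  have -> : \sum_i v h i c = 0.
    have /rowP/(_ (tagnat.Rank h c)) := V0; rewrite mulmx_blkdiagE [RHS]mxE => uV.
    rewrite -[RHS]uV.
    by apply: eq_bigr => i _; rewrite [const_mx _ _ _]mxE mul1r.
  move=> /(_ erefl) le; under eq_bigr do rewrite WE mxE.
  under [X in _ <= _ * X]eq_bigr do rewrite WE.
  apply: (le_trans le); rewrite ler_wpM2r ?le_bigmax //.
  by apply: sumr_ge0 => i _; rewrite mulr_ge0 ?sqr_ge0 // invr_ge0 ltW.
have xs_game : const_mx 1 *m stacked_gradient f (const_mx 1 *m xs) = 0 :> 'rV[R]_q.
  by apply: etrans xs0; exact: game_map_stacked.
have mono_stacked (x y : 'rV[R]_q) : mu * wsq (const_mx 1) (x - y) <=
    \sum_j ((const_mx 1 : 'rV_n) *m stacked_gradient f (const_mx 1 *m x) -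
             const_mx 1 *m stacked_gradient f (const_mx 1 *m y)) 0 j * (x - y) 0 j.
  by rewrite !game_map_stacked.
have P_supp i j : ~~ supp i j -> P i j = 0 by exact: blk_supp.
have [alpha al0 conv] := tracking_linear_convergence rv0 rvR R_one rv_one sgA0 sgA1
  R_contr uno_C C_P uno_P P_supp w0 W0 sgC0 sgC1 C_contr L2 G_lip mu0 mono_stacked xs_game.
exists alpha => // X Y Y0 XS YS.
have [||||K [rho [K0 rho0 rho1 HK]]] := conv X (fun k => blkdiag (Y k)).
- by move=> k; exact: blk_supp.
- congr (_ *m _); apply: eq_blkdiag => [h i c|h k i c]; last exact: blkdiagE_neq.
  by rewrite blkdiagE Y0.
- exact: XS.
- move=> k; rewrite mul_mxdiag_blkdiag -blkdiagD -blkdiagN -blkdiagD.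
  by congr blkdiag; apply: functional_extensionality_dep => h; rewrite YS.
(* The available bound is on squared norms, so the rate for norms is the square root of [rho]. *)
have rs0 : 0 < Num.sqrt rho by rewrite sqrtr_gt0.
have rs1 : Num.sqrt rho < 1 by rewrite -sqrtr1 ltr_sqrt.
have bound0 k : 0 <= Num.sqrt K * Num.sqrt rho ^+ k.
  by rewrite mulr_ge0 ?exprn_ge0 ?sqrtr_ge0.
have row_le i k : wsq (const_mx 1) (row i (X k) - xs) <=
    (Num.sqrt K * Num.sqrt rho ^+ k) ^+ 2.
  rewrite exprMn sqr_sqrtr ?(ltW K0) // exprAC sqr_sqrtr ?(ltW rho0) //.
  apply: le_trans (HK k); rewrite /wsq big_ord1 [leRHS](bigD1 i) //=.
  rewrite -[leLHS]addr0; apply: lerD.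
    by apply: ler_sum => j _; rewrite !mxE big_ord1 !mxE !mul1r.
  apply: sumr_ge0 => k' _; apply: sumr_ge0 => j _.
  by rewrite mxE mul1r sqr_ge0.
split=> [i|]; last first.
  exists (Num.sqrt K), (Num.sqrt rho); split=> //; first by rewrite sqrtr_gt0.
  by move=> i k; exact: norm2_le.
have geo : (fun k => Num.sqrt K * Num.sqrt rho ^+ k) @ \oo --> (0 : R).
  by apply: cvg_geometric; rewrite gtr0_norm.
apply/cvgrPdist_le => e e0.
have [N _ HN] := (@cvgr0Pnorm_le _ _ _ _ _ _).1 geo _ e0.
exists N => // k Nk; rewrite distrC.
(* Topological convergence is measured in the sup norm, which the Euclidean norm dominates. *)
apply: le_trans (norm_le_wsq (bound0 k) (row_le i k)) _.
by have := HN k Nk; rewrite /= ger0_norm.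
Qed.
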